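(* Let $m\ge 5$ and let $D(p)$ be the rank difference function associated with the family of finite tilings $(G_t(m))_{t\ge m}$. If $p<p_c(G(m))$, then $$p-\frac{2}{m}+D(p)=0 .$$
   Context: **Infinite graph and critical probability.** For $m\ge 5$, $G(m)$ is the infinite planar graph that is $m$-regular and tiles the (hyperbolic) plane by faces of length $m$. In bond percolation with parameter $p\in[0,1]$, each edge is independently open with probability $p$ and closed otherwise. For a fixed edge $e$ of $G(m)$, let $f(p)$ be the probability that $e$ belongs to an infinite connected component of the open subgraph (independent of $e$ by edge-transitivity). The critical probability $p_c(G(m))$ is the supremum of the set of $p$ with $f(p)=0$. **Tilings.** A tiling $G=(V,E,F)$ of a surface is a graph $(V,E)$ cellularly embedded in a smooth surface, $F$ being its set of faces; a face is identified with the set of edges on its boundary. Its dual tiling $G^*=(V^*,E^*,F^* )$ has $V^*=F$; each edge of $E$ lies in exactly two faces and gives an edge of $E^*$ joining these two faces, so $E$ and $E^*$ are identified; the faces of $G^*$ correspond to the vertices of $G$. The graph and its dual have no loops or multiple edges. **Finite tilings.** $(G_t(m))_{t\ge m}$, $G_t(m)=(V_t,E_t,F_t)$, also written $G_t$, is a fixed family of finite connected tilings of surfaces (Širáň's family) obtained as coset tilings of finite quotients $\bar T$ (reductions modulo suitable primes of a matrix representation) of $T(m)=\langle a,b\mid a^m=b^m=(ab)^2=1\rangle$: vertices, edges and faces are the left cosets of $\langle a\rangle$, $\langle ab\rangle$, $\langle b\rangle$ in $\bar T$, incidence being non-empty intersection. These tilings are $m$-regular with all faces of length $m$; vertex-,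 edge- and face-transitive; self-dual; every ball of radius $t$ of $G_t(m)$ is isomorphic (as a piece of a tiling, i.e. respecting vertices, edges and faces) to every ball of radius $t$ in $G(m)$; and there is a constant $K$ such that $|V_t|\le K^t$ for all $t$. **Rank difference function.** For $\varepsilon\subset E_t$, let $\bar\varepsilon=E_t\setminus\varepsilon$; $G_{t,\varepsilon}$ is the subgraph of $G_t$ with vertex set $V_t$ and edge set $\varepsilon$, and $G^*_{t,\bar\varepsilon}$ is the subgraph of $G_t^*$ with vertex set $V_t^*$ and edge set $\bar\varepsilon$ (regarded as a subset of $E_t^*$). The rank of a graph is the rank over $\mathbb{F}_2$ of its vertex-edge incidence matrix. Let $\mathbb{E}_p$ be expectation when $\varepsilon$ contains each edge of $E_t$ independently with probability $p$. Then $$D(p)=\limsup_{t\to\infty}\mathbb{E}_p\left(\frac{\operatorname{rank}G^*_{t,\bar\varepsilon}-\operatorname{rank}G_{t,\varepsilon}}{|E_t|}\right).$$ *)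

(* Defs.v *)
From Stdlib Require Import Relation_Operators.
From HB Require Import structures.
From mathcomp Require Import all_boot all_order all_algebra all_fingroup.
From mathcomp Require Import all_classical all_reals all_analysis.

Set Implicit Arguments.
Unset Strict Implicit.
Unset Printing Implicit Defensive.

Import Order.TTheory GRing.Theory Num.Theory.

(* Vertices, edges and faces with the vertex-edge and face-edge incidences.
   Graph and dual share the edge set, so duality swaps the two incidences. *)
Record tiling (V E F : Type) := Tiling {
  incV : V -> E -> bool ;
  incF : F -> E -> bool }.

Definition dual (V E F : Type) (G : tiling V E F) : tiling F E V :=
  Tiling (incF G) (incV G).

Section CosetTiling.
Variable gT : finGroupType.
Local Open Scope group_scope.

Definition is_left_coset (H X : {set gT}) : bool :=
  X \in lcosets H [set: gT]%SET.

Definition left_cosets (x : gT) : Type :=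
  {X : {set gT} | is_left_coset <[x]> X}.

HB.instance Definition _ (x : gT) := Finite.on (left_cosets x).

Definition meet_cosets (x y : gT) (X : left_cosets x) (Y : left_cosets y) :
  bool := sval X :&: sval Y != finset.set0.

Definition coset_tiling (a b : gT) :
    tiling (left_cosets a) (left_cosets (a * b)) (left_cosets b) :=
  Tiling (@meet_cosets a (a * b)) (@meet_cosets b (a * b)).

End CosetTiling.

Section FiniteTiling.
Variable R : realType.
Local Open Scope ring_scope.

Definition subgraph_rank (V E F : finType) (G : tiling V E F)
    (eps : {set E}) : nat :=
  \rank (\matrix_(i < #|V|, j < #|eps|)
           ((incV G (enum_val i : V) (enum_val j : E))%:R : 'F_2)).

Definition bernoulli_expectation (E : finType) (p : R)
    (X : {set E} -> R) : R :=
  \sum_(eps : {set E}) p ^+ #|eps| * (1 - p) ^+ #|finset.setC eps| * X eps.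

Definition mean_rank_difference (V E F : finType) (G : tiling V E F)
    (p : R) : R :=
  bernoulli_expectation p (fun eps : {set E} =>
    ((subgraph_rank (dual G) (finset.setC eps))%:R
       - (subgraph_rank G eps)%:R) / #|E|%:R).

(* The terms with t < m do not affect the limit superior. *)
Definition rank_difference (gT : nat -> finGroupType) (a b : forall t, gT t)
    (p : R) : R :=
  limn_sup (fun t => mean_rank_difference (coset_tiling (a t) (b t)) p).

End FiniteTiling.

Local Open Scope classical_set_scope.

Section Tilings.
Variables (V E F : Type) (G : tiling V E F).

Definition endpoints (e : E) (u v : V) : Prop :=
  u <> v /\ forall w, incV G w e <-> w = u \/ w = v.

Definition simple_graph : Prop :=
  (forall e, exists u v, endpoints e u v) /\
  (forall e e' u v, endpoints e u v -> endpoints e' u v -> e = e').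

(* The boundary of f is the simple cycle through v 0, ..., v (n - 1). *)
Definition boundary_cycle (f : F) (n : nat) (v : 'I_n -> V) : Prop :=
  exists e : 'I_n -> E,
    [/\ injective v, injective e,
        forall e', incF G f e' <-> exists i, e i = e' &
        forall i, endpoints (e i) (v i) (v (ordS i))].

Definition adjacent (A : set E) (u v : V) : Prop :=
  exists2 e, A e & endpoints e u v.

(* u :: s is a walk using only edges in A *)
Fixpoint walk (A : set E) (u : V) (s : seq V) : Prop :=
  if s is v :: s' then adjacent A u v /\ walk A v s' else True.

Definition component (A : set E) (u : V) : set V :=
  [set v | exists2 s, walk A u s & last u s = v].

Definition connected_graph : Prop := forall u v, component setT u v.

Definition regular (m : nat) : Prop :=
  forall v, ([set e | incV G v e] #= `I_m)%card.

Definition ball_vertices (c : V) (t : nat) : set V :=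
  [set v | exists s, [/\ walk setT c s, last c s = v & (size s <= t)%N]].

Definition ball_edges (c : V) (t : nat) : set E :=
  [set e | forall v, incV G v e -> ball_vertices c t v].

Definition ball_faces (c : V) (t : nat) : set F :=
  [set f | forall e, incF G f e -> ball_edges c t e].

(* Elementary homotopies of walks: erase a spur, or a turn around a face. *)
Inductive elementary_homotopy : seq V -> seq V -> Prop :=
| homotopy_spur s u v s' : adjacent setT u v ->
    elementary_homotopy (s ++ [:: u, v, u & s']) (s ++ u :: s')
| homotopy_face s f n (v : 'I_n.+1 -> V) s' : boundary_cycle f v ->
    elementary_homotopy (s ++ map v (enum 'I_n.+1) ++ v ord0 :: s')
                        (s ++ v ord0 :: s').

Definition simply_connected : Prop :=
  forall u s, walk setT u s -> last u s = u ->
    clos_refl_sym_trans _ elementary_homotopy (u :: s) [:: u].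

End Tilings.

(* A graph without loops or multiple edges cellularly embedded in a surface
   without boundary, whose dual has no loops or multiple edges.  The cell
   complex obtained by filling the face cycles is such a surface as soon as
   every edge lies in exactly two faces and the faces around each vertex
   are cyclically arranged, i.e. form a boundary cycle of the dual. *)
Definition is_tiling (V E F : Type) (G : tiling V E F) : Prop :=
  [/\ simple_graph G, simple_graph (dual G),
      forall f, exists n (v : 'I_n -> V), boundary_cycle G f v &
      forall v, exists n (f : 'I_n -> F), boundary_cycle (dual G) v f].

(* The surface tiled by G is the plane: it is connected, simply connected and
   non-compact (the tiling is infinite). *)
Definition planar_tiling (V E F : Type) (G : tiling V E F) : Prop :=
  [/\ is_tiling G, connected_graph G, simply_connected G &
      infinite_set [set: V]].

(* G is G(m); it is unique up to isomorphism. *)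
Definition regular_planar_tiling (m : nat) (V E F : Type)
    (G : tiling V E F) : Prop :=
  [/\ planar_tiling G, regular G m & regular (dual G) m].

Record tiling_iso (V E F V' E' F' : Type)
    (G : tiling V E F) (H : tiling V' E' F')
    (fV : V -> V') (fE : E -> E') (fF : F -> F') : Prop := {
  iso_bijV : bijective fV ;
  iso_bijE : bijective fE ;
  iso_bijF : bijective fF ;
  iso_incV : forall v e, incV H (fV v) (fE e) = incV G v e ;
  iso_incF : forall f e, incF H (fF f) (fE e) = incF G f e }.

Definition self_dual (V E F : Type) (G : tiling V E F) : Prop :=
  exists fV fE fF, tiling_iso G (dual G) fV fE fF.

Definition vertex_transitive (V E F : Type) (G : tiling V E F) : Prop :=
  forall u v, exists fV fE fF, tiling_iso G G fV fE fF /\ fV u = v.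

Definition edge_transitive (V E F : Type) (G : tiling V E F) : Prop :=
  forall e e', exists fV fE fF, tiling_iso G G fV fE fF /\ fE e = e'.

Definition face_transitive (V E F : Type) (G : tiling V E F) : Prop :=
  forall f f', exists fV fE fF, tiling_iso G G fV fE fF /\ fF f = f'.

Definition isomorphic_balls (V E F V' E' F' : Type)
    (G : tiling V E F) (c : V) (H : tiling V' E' F') (c' : V')
    (t : nat) : Prop :=
  exists fV fE fF,
    [/\ [/\ set_bij (ball_vertices G c t) (ball_vertices H c' t) fV,
            set_bij (ball_edges G c t) (ball_edges H c' t) fE &
            set_bij (ball_faces G c t) (ball_faces H c' t) fF],
        forall v e, ball_vertices G c t v -> ball_edges G c t e ->
          incV H (fV v) (fE e) = incV G v e &
        forall f e, ball_faces G c t f -> ball_edges G c t e ->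
          incF H (fF f) (fE e) = incF G f e].

(* gT, generated by a and b, is a finite quotient of
   T(m) = < a, b | a^m = b^m = (ab)^2 = 1 >. *)
Record quotient_tiling (m : nat) (V E F : Type) (G : tiling V E F)
    (t : nat) (gT : finGroupType) (a b : gT) : Prop := {
  qt_generators : (<<[set a; b]%SET>> = [set: gT]%SET)%g ;
  qt_relations : [/\ a ^+ m = 1, b ^+ m = 1 & (a * b) ^+ 2 = 1]%g ;
  qt_tiling : is_tiling (coset_tiling a b) ;
  qt_connected : connected_graph (coset_tiling a b) ;
  qt_regular : regular (coset_tiling a b) m ;
  qt_face_length : regular (dual (coset_tiling a b)) m ;
  qt_vertex_transitive : vertex_transitive (coset_tiling a b) ;
  qt_edge_transitive : edge_transitive (coset_tiling a b) ;
  qt_face_transitive : face_transitive (coset_tiling a b) ;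
  qt_self_dual : self_dual (coset_tiling a b) ;
  qt_balls : forall u v, isomorphic_balls (coset_tiling a b) u G v t }.

Definition finite_tilings (m : nat) (V E F : Type) (G : tiling V E F)
    (gT : nat -> finGroupType) (a b : forall t, gT t) : Prop :=
  (forall t, (m <= t)%N -> quotient_tiling m G t (a t) (b t)) /\
  (exists K : nat, forall t, (m <= t)%N ->
    (#|{: left_cosets (a t)}| <= K ^ t)%N).

Section Percolation.
Variables (R : realType) (d : measure_display) (Omega : measurableType d).
Local Open Scope ring_scope.

(* [open e] is the event that e is open; these events are mutually
   independent and have probability p. *)
Record bernoulli_percolation (E : Type) (P : probability Omega R)
    (open : E -> set Omega) (p : R) : Prop := {
  percolation_measurable : forall e, measurable (open e) ;
  percolation_prob : forall e, P (open e) = p%:E ;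
  percolation_independent : forall n (e : 'I_n -> E), injective e ->
    P (\bigcap_(i in [set: 'I_n]) open (e i)) =
      (\prod_(i < n) P (open (e i)))%E }.

Definition infinite_cluster (V E F : Type) (G : tiling V E F)
    (A : set E) (e : E) : Prop :=
  A e /\ exists2 v, incV G v e & infinite_set (component G A v).

Definition percolation_function (V E F : Type) (G : tiling V E F)
    (P : R -> probability Omega R) (open : R -> E -> set Omega)
    (e : E) (p : R) : R :=
  fine (P p [set w | infinite_cluster G [set e' | open p e' w] e]).

Definition critical_probability (V E F : Type) (G : tiling V E F)
    (P : R -> probability Omega R) (open : R -> E -> set Omega)
    (e : E) : R :=
  sup [set p | 0 <= p <= 1 /\ percolation_function G P open e p = 0].

End Percolation.

(* Main.v *)
Require Import Defs.
From mathcomp Require Import all_boot all_order all_algebra all_fingroup.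
From mathcomp Require Import all_classical all_reals all_analysis.
From mathcomp Require Import ring lra zify.

Set Implicit Arguments.
Unset Strict Implicit.
Unset Printing Implicit Defensive.

Import Order.TTheory GRing.Theory Num.Theory.

(** Fix a set [eps] of open edges of a finite tiling H, with vertices V, edges
    E and faces F.  Modulo 2, the cycles of [eps] form a space of dimension
    |eps| - rank of the open graph, and the boundaries of sets of faces that
    are supported on [eps] form a space of dimension
    rank B - rank of the dual graph of closed edges, where B is the face-edge
    incidence matrix.  Boundaries are cycles, so

      rank (dual, closed) - rank (primal, open) = rank B - |eps| + h(eps),

    where h(eps) >= 0 is the number of independent cycles of [eps] modulo
    boundaries.  As the dual graph is connected, rank B >= |F| - 1, and
    m |F| = 2 |E|; dividing by |E| and averaging gives

      2/m - p - 1/|E| <= mean rank difference <= 2/m - p + E[h(eps)] / |E|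

    ([mean_rank_difference_ge], [mean_rank_difference_le]).  Since |E| tends to
    infinity with t, everything reduces to E[h(eps)] = o(|E|).

    Fix N and put aside the open edges from an end of which an open simple path
    of length N starts.  If such a path starts at every vertex of a component
    of [eps], then all edges of the component are put aside; otherwise every
    cycle in the component is a sum of closed walks of length at most 2N
    ([cycle_sub_boundary]).  In the plane a closed walk bounds: erasing a spur
    does not change it modulo 2 and erasing a turn around a face changes it by
    a boundary ([contractible_crossings]).  There are finitely many closed
    walks of length at most 2N at a vertex, so they all bound inside one ball,
    whose radius depends on N only ([short_closed_walks_bound]).  As soon as t is
    larger than that radius the finite tiling contains a copy of the ball, and
    its closed walks of length at most 2N bound as well.  Hence h(eps) is at
    most the number of edges put aside.

    By edge-transitivity, and again because balls are copied, the expected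
    proportion of the edges put aside is the probability that a given edge e of
    the infinite graph is open and an open simple path of length N starts at
    one of its ends, an increasing event that depends on finitely many edges.
    Its probability at p is at most that at some q > p where e almost surely
    lies in no infinite cluster ([long_path_probability_le]), and at q it tends
    to 0 as N grows, because in a locally finite graph e lies in an infinite
    cluster if and only if these events occur for all N
    ([infinite_cluster_long_path]). *)

(** * Chains supported on a set of edges *)

Local Open Scope ring_scope.

Section ColumnSelection.
Variables (K : fieldType) (E : finType).

(** The rows are the unit vectors of the elements of [S]: the row space consists
    of the chains supported on [S], and multiplication by the transpose
    restricts chains to [S]. *)
Definition select (S : {set E}) : 'M[K]_(#|S|, #|E|) :=
  \matrix_(i, j) (enum_val i == enum_val j)%:R.

Lemma mulmx_selectT n (M : 'M[K]_(n, #|E|)) (S : {set E}) :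
  M *m (select S)^T = \matrix_(i, j) M i (enum_rank (enum_val j : E)).
Proof.
apply/matrixP=> i j; rewrite !mxE (bigD1 (enum_rank (enum_val j))) //=.
rewrite big1 ?addr0 => [|k neq]; rewrite !mxE ?enum_rankK ?eqxx ?mulr1 //.
case: eqP => [eqk|_]; last by rewrite mulr0.
by case/eqP: neq; rewrite eqk enum_valK.
Qed.

Lemma select_selectT (S : {set E}) : select S *m (select S)^T = 1%:M.
Proof.
rewrite mulmx_selectT; apply/matrixP=> i j.
by rewrite !mxE enum_rankK (inj_eq enum_val_inj).
Qed.

Lemma rank_select (S : {set E}) : \rank (select S) = #|S|.
Proof. by apply/eqP/row_freeP; exists (select S)^T; apply: select_selectT. Qed.

Lemma sub_selectP n (x : 'M[K]_(n, #|E|)) (S : {set E}) :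
  reflect (forall i g, g \notin S -> x i (enum_rank g) = 0)
          (x <= select S)%MS.
Proof.
apply: (iffP idP) => [/submxP[y ->] i g gS | x0].
  rewrite mxE big1 // => j _; rewrite mxE enum_rankK.
  case: eqP => [eqg|_]; last by rewrite mulr0.
  by move: gS; rewrite -eqg enum_valP /=.
apply/submxP; exists (x *m (select S)^T); rewrite mulmx_selectT.
apply/matrixP=> i j; rewrite mxE.
have [jS|jS] := boolP (enum_val j \in S); last first.
  rewrite -{1}[j]enum_valK x0 // big1 // => k _; rewrite !mxE.
  case: eqP => [eqk|_]; last by rewrite mulr0.
  by move: jS; rewrite -eqk enum_valP /=.
rewrite (bigD1 (enum_rank_in jS (enum_val j))) //= big1 ?addr0 => [|k neq].
  by rewrite !mxE enum_rankK_in // eqxx mulr1 enum_valK.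
rewrite !mxE; case: eqP => [eqk|_]; last by rewrite mulr0.
by case/eqP: neq; apply: enum_val_inj; rewrite enum_rankK_in.
Qed.

(** The rows of [B] span the boundaries and the kernel of [A] is the cycle
    space; both ranks are read off by restricting these two spaces to chains
    supported on [eps].  Boundaries are cycles, so the first restriction has
    the smaller dimension. *)
Lemma rank_select_lower nv nf (A : 'M[K]_(#|E|, nv)) (B : 'M[K]_(nf, #|E|))
    (eps : {set E}) :
  B *m A = 0 ->
  (\rank B + \rank (select eps *m A) <=
     #|eps| + \rank (B *m (select (~: eps))^T))%N.
Proof.
move=> BA0; rewrite -(mxrank_mul_ker B (select (~: eps))^T).
rewrite -[in leqRHS](rank_select eps) -(mxrank_mul_ker (select eps) A).
rewrite [leqRHS]addnC -addnA leq_add2l addnC leq_add2l mxrankS //.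
rewrite sub_capmx; apply/andP; split; last first.
  apply: submx_trans (capmxSl _ _) _; apply/sub_kermxP; exact: BA0.
apply/sub_selectP => i g gS.
have /sub_kermxP := capmxSr B (kermx (select (~: eps))^T).
rewrite mulmx_selectT => /matrixP.
have gC : g \in ~: eps by rewrite finset.in_setC.
by move=> /(_ i (enum_rank_in gC g)); rewrite !mxE enum_rankK_in.
Qed.

(** If the boundaries together with the chains on a small set [bad] of edges
    already contain all cycles of [eps], then the two dimensions differ by at
    most [#|bad|]. *)
Lemma rank_select_upper nv nf (A : 'M[K]_(#|E|, nv)) (B : 'M[K]_(nf, #|E|))
    (eps bad : {set E}) :
  bad \subset eps ->
  (select eps :&: kermx A <= B + select bad)%MS ->
  (#|eps| + \rank (B *m (select (~: eps))^T) <=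
     \rank B + \rank (select eps *m A) + #|bad|)%N.
Proof.
move=> bad_eps sub.
rewrite -(mxrank_mul_ker B (select (~: eps))^T).
rewrite -[in leqLHS](rank_select eps) -(mxrank_mul_ker (select eps) A).
rewrite -(rank_select bad) [leqLHS]addnC -!addnA leq_add2l addnCA leq_add2l.
suff sub2 : (select eps :&: kermx A <=
    (B :&: kermx (select (~: eps))^T) + select bad)%MS.
  exact: leq_trans (mxrankS sub2) (mxrank_adds_leqif _ _).
have [[u v] /= eqz] := sub_addsmxP sub.
rewrite eqz addmx_sub_adds ?submxMl // sub_capmx submxMl.
apply/sub_kermxP; rewrite mulmx_selectT; apply/matrixP=> i j; rewrite !mxE.
set g : E := enum_val j.
have gS : g \notin eps by rewrite -finset.in_setC enum_valP.
have gB : g \notin bad by apply: contra gS; apply: (fintype.subsetP bad_eps).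
have /sub_selectP/(_ i g gS) := capmxSl (select eps) (kermx A).
rewrite eqz mxE => /(canRL (addrK _)); rewrite sub0r mxE => ->.
have /sub_selectP/(_ i g gB) := submxMl v (select bad).
by rewrite mxE => ->; rewrite oppr0.
Qed.

End ColumnSelection.

(** * Bernoulli configurations on a finite set *)

Section BernoulliExpectation.
Variable R : realType.
Implicit Types (p q c : R).

Definition bernoulli_weight p (b : bool) : R := if b then p else 1 - p.

Lemma bernoulli_expectationE (E : finType) p (X : {set E} -> R) :
  bernoulli_expectation p X =
  \sum_(f : {ffun E -> bool})
     (\prod_i bernoulli_weight p (f i)) * X [set i | f i]%SET.
Proof.
rewrite /bernoulli_expectation.
rewrite (reindex (fun f : {ffun E -> bool} => [set i | f i]%SET)) /=.
  apply: eq_bigr => f _; congr (_ * _).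
  rewrite -!prodr_const [in RHS](bigID f) /=; congr (_ * _).
    by apply: eq_big => [i|i]; rewrite !inE // => ->.
  apply: eq_big => [i|i]; rewrite !inE // => /negbTE.
  by rewrite /bernoulli_weight => ->.
exists (fun S : {set E} => [ffun i => i \in S]) => [f|S] _.
  by apply/ffunP=> i; rewrite ffunE inE.
by apply/setP=> i; rewrite inE ffunE.
Qed.

Lemma bernoulli_weight_sum p : \sum_b bernoulli_weight p b = 1.
Proof. by rewrite big_bool /= addrC subrK. Qed.

(** The restriction of a Bernoulli configuration to a subset of the edges is
    again Bernoulli: the states of the other edges sum out to 1. *)
Lemma bernoulli_expectation_preim (J E : finType) (j : J -> E) p
    (X : {set J} -> R) :
  injective j ->
  bernoulli_expectation p (fun eps => X (j @^-1: eps)%SET) =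
  bernoulli_expectation p X.
Proof.
move=> j_inj; rewrite !bernoulli_expectationE.
pose res (f : {ffun E -> bool}) := [ffun i => f (j i)].
rewrite (partition_big res xpredT) //=; apply: eq_bigr => g _.
have marginal : \sum_(f | res f == g) \prod_i bernoulli_weight p (f i) =
                \prod_i bernoulli_weight p (g i).
  (* The configurations restricting to g form a product set: the state of j i
     is imposed, that of any other edge is free. *)
  pose Q e b := [forall i, (j i == e) ==> (b == g i)].
  have -> : \sum_(f | res f == g) \prod_i bernoulli_weight p (f i) =
            \sum_(f in family Q) \prod_i bernoulli_weight p (f i).
    apply: eq_bigl => f; apply/eqP/familyP => [resf e|Qf].
      by apply/forallP => i; apply/implyP => /eqP <-; rewrite -resf ffunE.
    apply/ffunP => i; rewrite ffunE; apply/eqP.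
    by have /forallP/(_ i)/implyP := Qf (j i); apply.
  rewrite -(bigA_distr_big_dep Q (fun _ => bernoulli_weight p)).
  rewrite (bigID (mem (j @: [set: J])%SET)) /=.
  rewrite [X in _ * X]big1 ?mulr1 => [|e notj].
    rewrite big_imset /=; last by move=> ? ? _ _; apply: j_inj.
    rewrite (eq_bigl xpredT) => [|i]; last by rewrite finset.in_setT.
    apply: eq_bigr => i _; rewrite (big_pred1 (g i)) // => b.
    apply/forallP/eqP => [/(_ i)|-> k]; first by rewrite eqxx => /eqP.
    by apply/implyP => /eqP/j_inj ->.
  rewrite (eq_bigl xpredT) ?bernoulli_weight_sum // => b.
  apply/forallP => i; apply/implyP => /eqP ji; case/negP: notj.
  by rewrite -ji imset_f ?finset.in_setT.
rewrite -marginal mulr_suml; apply: eq_bigr => f /eqP <-; congr (_ * X _).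
by apply/setP => i; rewrite !inE ffunE.
Qed.

Lemma bernoulli_weight_ge0 p b : 0 <= p <= 1 -> 0 <= bernoulli_weight p b.
Proof. by case/andP=> p0 p1; case: b => //=; rewrite subr_ge0. Qed.

Lemma le_bernoulli_expectation (E : finType) p (X Y : {set E} -> R) :
  0 <= p <= 1 -> (forall eps, X eps <= Y eps) ->
  bernoulli_expectation p X <= bernoulli_expectation p Y.
Proof.
move=> p01 XY; rewrite !bernoulli_expectationE; apply: ler_sum => f _.
by apply: ler_wpM2l => //; apply: prodr_ge0 => i _; apply: bernoulli_weight_ge0.
Qed.

(** The joint law of a coupled pair of edge states with parameters [p <= q],
    in which an edge open at [p] is always open at [q]. *)
Definition coupling_weight p q (b b' : bool) : R :=
  match b, b' with
  | true, true => p
  | false, true => q - p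
  | false, false => 1 - q
  | true, false => 0
  end.

(** Expand both expectations over the coupled pairs: only the pairs of
    configurations [f <= g] have non-zero weight. *)
Lemma bernoulli_expectation_mono (E : finType) p q (X : {set E} -> R) :
  0 <= p -> p <= q -> q <= 1 ->
  (forall S S' : {set E}, S \subset S' -> X S <= X S') ->
  bernoulli_expectation p X <= bernoulli_expectation q X.
Proof.
move=> p0 pq q1 X_mono; rewrite !bernoulli_expectationE.
have wp b : bernoulli_weight p b = \sum_b' coupling_weight p q b b'.
  by rewrite big_bool; case: b => /=; rewrite ?addr0 // addrC addrA subrK.
have wq b' : bernoulli_weight q b' = \sum_b coupling_weight p q b b'.
  by rewrite big_bool; case: b' => /=; rewrite ?add0r // addrC subrK.
pose K (f g : {ffun E -> bool}) := \prod_i coupling_weight p q (f i) (g i).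
have -> : \sum_(f : {ffun E -> bool})
    (\prod_i bernoulli_weight p (f i)) * X [set i | f i]%SET =
    \sum_f \sum_g K f g * X [set i | f i]%SET.
  apply: eq_bigr => f _; under eq_bigr do rewrite wp.
  by rewrite bigA_distr_bigA mulr_suml.
have -> : \sum_(f : {ffun E -> bool})
    (\prod_i bernoulli_weight q (f i)) * X [set i | f i]%SET =
    \sum_f \sum_g K f g * X [set i | g i]%SET.
  rewrite exchange_big /=; apply: eq_bigr => g _; under eq_bigr do rewrite wq.
  rewrite (bigA_distr_bigA (fun i b => coupling_weight p q b (g i))).
  by rewrite mulr_suml.
apply: ler_sum => f _; apply: ler_sum => g _.
have K_ge0 : 0 <= K f g.
  apply: prodr_ge0 => i _; case: (f i) (g i) => [] [] //=; by rewrite subr_ge0.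
have [/forallP fg|/forallPn[i]] := boolP [forall i, f i ==> g i].
  apply: ler_wpM2l => //; apply: X_mono; apply/fintype.subsetP => i.
  by rewrite !inE; apply/implyP.
rewrite negb_imply => /andP[fi /negbTE gi].
by rewrite /K (bigD1 i) //= fi gi /= !mul0r.
Qed.

Lemma bernoulli_expectationD (E : finType) p (X Y : {set E} -> R) :
  bernoulli_expectation p (fun eps => X eps + Y eps) =
  bernoulli_expectation p X + bernoulli_expectation p Y.
Proof.
rewrite /bernoulli_expectation -big_split.
by apply: eq_bigr => i _; rewrite mulrDr.
Qed.

Lemma bernoulli_expectationZ (E : finType) p c (X : {set E} -> R) :
  bernoulli_expectation p (fun eps => c * X eps) =
  c * bernoulli_expectation p X.
Proof.
rewrite /bernoulli_expectation mulr_sumr.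
by apply: eq_bigr => i _; rewrite mulrCA.
Qed.

Lemma bernoulli_expectation_sum (E I : finType) p (X : I -> {set E} -> R) :
  bernoulli_expectation p (fun eps => \sum_i X i eps) =
  \sum_i bernoulli_expectation p (X i).
Proof.
rewrite /bernoulli_expectation exchange_big; apply: eq_bigr => eps _.
by rewrite mulr_sumr.
Qed.

Lemma bernoulli_expectation_cst (E : finType) p c :
  bernoulli_expectation p (fun _ : {set E} => c) = c.
Proof.
rewrite bernoulli_expectationE -mulr_suml.
rewrite -(bigA_distr_bigA (fun _ => bernoulli_weight p)).
by rewrite big1 ?mul1r // => i _; rewrite bernoulli_weight_sum.
Qed.

Lemma bernoulli_expectation_mem (E : finType) p (g : E) :
  bernoulli_expectation p (fun eps : {set E} => (g \in eps)%:R) = p.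
Proof.
transitivity (bernoulli_expectation p
    (fun S : {set unit} => (tt \in S)%:R : R)).
  have g_inj : injective (fun _ : unit => g) by move=> [] [].
  rewrite -(bernoulli_expectation_preim _ _ g_inj).
  by congr (bernoulli_expectation p _); apply/funext => eps; rewrite inE.
rewrite bernoulli_expectationE.
rewrite (reindex (fun b : bool => [ffun _ : unit => b])) /=.
  rewrite big_bool /= (big_pred1 tt) => [|[]//].
  by rewrite !inE !ffunE !mulr1 mulr0 addr0.
exists (fun f : {ffun unit -> bool} => f tt) => [b|f] _; first by rewrite ffunE.
by apply/ffunP => -[]; rewrite ffunE.
Qed.

Lemma bernoulli_expectation_card (E : finType) p :
  bernoulli_expectation p (fun eps : {set E} => #|eps|%:R) = p * #|E|%:R.
Proof.
transitivity (bernoulli_expectation p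
    (fun eps : {set E} => \sum_i (i \in eps)%:R : R)).
  congr (bernoulli_expectation p _); apply/funext => eps.
  by rewrite -sum1_card natr_sum big_mkcond; apply: eq_bigr => i _; case: ifP.
rewrite bernoulli_expectation_sum mulr_natr -sumr_const.
by apply: eq_bigr => i _; rewrite bernoulli_expectation_mem.
Qed.

End BernoulliExpectation.

(** * Cylinder events of a percolation *)

Local Open Scope classical_set_scope.
Local Open Scope ring_scope.

Section CylinderEvents.
Variables (R : realType) (d : measure_display) (Omega : measurableType d).
Variables (E : Type) (J : finType) (j : J -> E) (open : E -> set Omega).

Definition cylinder (A B : {set J}) : set Omega :=
  (\bigcap_(i in [set` A]) open (j i)) `&`
  (\bigcap_(i in [set` B]) ~` open (j i)).

Definition open_indices (w : Omega) : {set J} :=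
  [set i | `[< open (j i) w >]]%SET.

Lemma cylinder_open_indices (S : {set J}) :
  cylinder S (~: S) = [set w | open_indices w = S].
Proof.
apply/seteqP; split=> w.
  move=> [openS closedS]; apply/setP => i; rewrite inE.
  have [iS|iS] := boolP (i \in S); first exact/asboolP/openS.
  by apply/asboolPn/closedS; rewrite /= finset.in_setC.
move=> <-; split=> i; rewrite /= !inE => /asboolP //.
Qed.

Hypothesis open_measurable : forall e, measurable (open e).

Lemma measurable_cylinder (A B : {set J}) : measurable (cylinder A B).
Proof.
apply: measurableI; apply: fin_bigcap_measurable => // i _.
exact: measurableC.
Qed.

Lemma open_indices_event (Phi : pred {set J}) :
  [set w | Phi (open_indices w)] =
  \bigcup_(S in [set` Phi]) cylinder S (~: S).
Proof.
apply/seteqP; split=> w.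
  by move=> Phiw; exists (open_indices w); rewrite // cylinder_open_indices.
by move=> [S PhiS]; rewrite cylinder_open_indices /= => ->.
Qed.

Lemma measurable_open_indices (Phi : pred {set J}) :
  measurable [set w | Phi (open_indices w)].
Proof.
rewrite open_indices_event; apply: fin_bigcup_measurable => // S _.
exact: measurable_cylinder.
Qed.

Variables (P : probability Omega R) (q : R).
Hypothesis percolation : bernoulli_percolation P open q.
Hypothesis j_inj : injective j.

(** Independence only speaks of open edges; closed edges are added one at a
    time by the rule P(C, b closed) = P(C) - P(C, b open). *)
Lemma probability_cylinder (A B : {set J}) : [disjoint A & B]%B ->
  P (cylinder A B) = (q ^+ #|A| * (1 - q) ^+ #|B|)%:E.
Proof.
move: {2}#|B| (erefl #|B|) => n; elim: n A B => [|n IHn] A B cardB AB.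
  rewrite cardB expr0 mulr1; move/eqP: cardB; rewrite cards_eq0 => /eqP ->.
  have -> : cylinder A finset.set0 =
      \bigcap_(i in [set: 'I_#|A|]) open (j (enum_val i)).
    apply/seteqP; split=> [w [oA _] i _|w oA].
      by apply: oA; rewrite /= enum_valP.
    split=> i /=; last by rewrite inE.
    by move=> iA; rewrite -(enum_rankK_in iA iA); apply: oA.
  rewrite (percolation_independent percolation); last first.
    by move=> i k /j_inj/enum_val_inj.
  under eq_bigr do rewrite (percolation_prob percolation).
  by rewrite prodEFin prodr_const card_ord.
have [b bB] : exists b, b \in B by apply/set0Pn; rewrite -cards_eq0 cardB.
have bA : b \notin A by rewrite (disjointFl AB).
pose B' := (B :\ b)%SET.
have cardB' : #|B'| = n by move: cardB; rewrite (cardsD1 b) bB => -[].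
have AB' : [disjoint A & B']%B by apply: disjointWr AB; apply: subsetDl.
have bAB' : [disjoint (b |: A)%SET & B']%B.
  rewrite finset.disjoints_subset; apply/fintype.subsetP => i.
  rewrite !inE => /orP[/eqP->|iA]; first by rewrite eqxx.
  by rewrite (disjointFr AB iA) andbF.
have -> : cylinder A B = cylinder A B' `\` open (j b).
  apply/seteqP; split=> w.
    move=> [oA cB]; split; last exact: cB.
    by split=> // i; rewrite /= !inE => /andP[_ iB]; apply: cB.
  move=> [[oA cB'] cb]; split=> // i; rewrite /= => iB.
  have [->//|ib] := eqVneq i b.
  by apply: cB'; rewrite /= !inE ib.
have inter : cylinder A B' `&` open (j b) = cylinder (b |: A)%SET B'.
  apply/seteqP; split=> w.
    move=> [[oA cB'] ob]; split=> // i; rewrite /= !inE => /orP[/eqP->//|].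
    exact: oA.
  move=> [oA cB']; split; last by apply: oA; rewrite /= !inE eqxx.
  by split=> // i iA; apply: oA; rewrite /= !inE iA orbT.
have finite : (P (cylinder A B') < +oo)%E.
  apply: le_lt_trans (probability_le1 _ _) (ltry _).
  exact: measurable_cylinder.
transitivity (P (cylinder A B') - P (cylinder (b |: A)%SET B'))%E.
  by rewrite -inter; apply: measureD finite => //; apply: measurable_cylinder.
rewrite (IHn _ _ cardB' AB') (IHn _ _ cardB' bAB').
rewrite cardB' cardB cardsU1 bA -EFinB.
by congr (_%:E); rewrite add1n !exprS; ring.
Qed.

Lemma probability_open_indices (Phi : pred {set J}) :
  P [set w | Phi (open_indices w)] =
  (bernoulli_expectation q (fun S => (Phi S)%:R))%:E.
Proof.
rewrite open_indices_event measure_fin_bigcup //=; last 2 first.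
- apply/trivIsetP => S S' _ _ /eqP SS'; apply/seteqP; split=> // w.
  by rewrite !cylinder_open_indices => -[/= -> ].
- by move=> S _; apply: measurable_cylinder.
rewrite -(bigfs _ (index_enum_uniq _)); last first.
  by move=> S _; rewrite mem_index_enum.
rewrite /bernoulli_expectation -sumEFin big_mkcond /=.
apply: eq_bigr => S _; case: ifP => _; last by rewrite mulr0.
by rewrite probability_cylinder ?mulr1 // finset.disjoints_subset finset.setCK.
Qed.

End CylinderEvents.

(** * Walks, balls and long paths *)

Section Adjacency.
Variables (V E F : Type) (G : tiling V E F).
Implicit Types (A B : set E) (u v w : V) (g h : E) (s : seq V).

Definition adjb A : rel V := fun u v => `[< Defs.adjacent G A u v >].

Lemma walkP A u s : walk G A u s <-> path (adjb A) u s.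
Proof.
elim: s u => //= v s IHs u.
split=> [[uv /IHs vs]|/andP[/asboolP uv /IHs vs]] //.
by rewrite vs andbT; apply/asboolP.
Qed.

Lemma endpoints_sym g u v : endpoints G g u v -> endpoints G g v u.
Proof.
move=> [uv inc]; split=> [/esym //|w]; rewrite inc.
by split=> -[]; [right|left|right|left].
Qed.

Lemma endpoints_incl g u v : endpoints G g u v -> incV G u g.
Proof. by move=> [_ inc]; apply/inc; left. Qed.

Lemma endpoints_incr g u v : endpoints G g u v -> incV G v g.
Proof. by move=> /endpoints_sym/endpoints_incl. Qed.

Lemma adjb_sym A : symmetric (adjb A).
Proof.
by move=> u v; apply/asboolP/asboolP => -[g Ag /endpoints_sym]; exists g.
Qed.

Lemma adjb_mono A B : A `<=` B -> subrel (adjb A) (adjb B).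
Proof.
by move=> AB u v /asboolP[g Ag uv]; apply/asboolP; exists g => //; apply: AB.
Qed.

Hypothesis simple : simple_graph G.

Lemma incV_endpoints g u : incV G u g -> exists v, endpoints G g u v.
Proof.
have [x [y xy]] := simple.1 g.
case: (xy) => _ inc /inc[->|->]; first by exists y.
by exists x; apply: endpoints_sym.
Qed.

Lemma adjb_setI A B u v : adjb A u v -> adjb B u v -> adjb (A `&` B) u v.
Proof.
move=> /asboolP[g Ag uv] /asboolP[h Bh uv']; apply/asboolP; exists g => //.
by split=> //; rewrite (simple.2 _ _ _ _ uv uv').
Qed.

Lemma path_setI A B u s :
  path (adjb A) u s -> path (adjb B) u s -> path (adjb (A `&` B)) u s.
Proof.
elim: s u => //= v s IHs u /andP[Auv Avs] /andP[Buv Bvs].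
by rewrite adjb_setI //= IHs.
Qed.

Lemma path_setT A u s : path (adjb A) u s -> path (adjb setT) u s.
Proof. by apply: sub_path; apply: adjb_mono => e _. Qed.

Lemma ball_vertices_step c k u v :
  ball_vertices G c k u -> adjb setT u v -> ball_vertices G c k.+1 v.
Proof.
move=> [s [/walkP us lasts ks]] uv; exists (rcons s v).
split; rewrite ?last_rcons ?size_rcons //.
by apply/walkP; rewrite rcons_path us lasts.
Qed.

Lemma ball_vertices_mono c k k' :
  (k <= k')%N -> ball_vertices G c k `<=` ball_vertices G c k'.
Proof.
by move=> kk' v [s [? ? sk]]; exists s; split => //; apply: leq_trans kk'.
Qed.

Lemma ball_edges_mono c k k' :
  (k <= k')%N -> ball_edges G c k `<=` ball_edges G c k'.
Proof. by move=> kk' g kg v vg; apply: ball_vertices_mono kk' _ (kg v vg). Qed.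

Lemma ball_faces_mono c k k' :
  (k <= k')%N -> ball_faces G c k `<=` ball_faces G c k'.
Proof. by move=> kk' f kf g fg; apply: ball_edges_mono kk' _ (kf g fg). Qed.

Lemma ball_vertices_center c k : ball_vertices G c k c.
Proof. by exists [::]; split. Qed.

Lemma ball_edges_incident c k u g :
  ball_vertices G c k u -> incV G u g -> ball_edges G c k.+1 g.
Proof.
move=> ku /incV_endpoints[v uv] w; case: (uv) => _ inc /inc[->|->].
  exact: ball_vertices_mono ku.
by apply: ball_vertices_step ku _; apply/asboolP; exists g.
Qed.

Lemma path_in_ball A c k u s : ball_vertices G c k u -> path (adjb A) u s ->
  path (adjb (A `&` ball_edges G c (k + size s))) u s.
Proof.
elim: s k u => //= v s IHs k u ku /andP[/asboolP[g Ag uv] vs].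
have ke := ball_edges_incident ku (endpoints_incl uv).
apply/andP; split.
  apply/asboolP; exists g => //; split=> //; apply: ball_edges_mono ke.
  by rewrite addnS ltnS leq_addr.
rewrite -addSnnS; apply: IHs vs.
by apply: ke; apply: endpoints_incr uv.
Qed.

End Adjacency.

Section LongPaths.
Variables (V : eqType) (E F : Type) (G : tiling V E F).
Implicit Types (A B : set E) (u v w : V) (g h : E) (s : seq V).

Definition long_path A N v : Prop :=
  exists s, [/\ path (adjb G A) v s, size s = N & uniq (v :: s)].

(** The size of a cluster is measured by its simple paths because these are
    carried along by any map of graphs that is injective on the ball concerned,
    while distances and whole clusters are not. *)
Definition on_long_path A N g : Prop :=
  A g /\ exists2 v, incV G v g & long_path A N v.

Lemma long_path_leq A N N' v :
  (N <= N')%N -> long_path A N' v -> long_path A N v.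
Proof.
move=> NN' [s [vs sN' /= /andP[vNs s_uniq]]]; exists (take N s).
split; first exact: take_path.
  by rewrite size_takel // sN'.
by rewrite /= take_uniq // andbT; apply: contra vNs; apply: mem_take.
Qed.

Lemma long_path_mono A B N v : A `<=` B -> long_path A N v -> long_path B N v.
Proof.
move=> AB [s [vs sN s_uniq]]; exists s; split=> //.
by apply: sub_path vs; apply: adjb_mono.
Qed.

Lemma on_long_path_leq A N N' g :
  (N <= N')%N -> on_long_path A N' g -> on_long_path A N g.
Proof.
by move=> NN' [Ag [v vg /(long_path_leq NN')]]; split=> //; exists v.
Qed.

Lemma on_long_path_mono A B N g :
  A `<=` B -> on_long_path A N g -> on_long_path B N g.
Proof.
by move=> AB [/AB Bg [v vg /(long_path_mono AB)]]; split=> //; exists v.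
Qed.

(** A walk can be shortened to a simple path, and an initial segment of a too
    long simple path would be a long path. *)
Lemma short_path A N u s : ~ long_path A N u -> path (adjb G A) u s ->
  exists s', [/\ path (adjb G A) u s', last u s' = last u s & (size s' < N)%N].
Proof.
move=> notlong us; case/shortenP: us => s' us' s'_uniq _.
exists s'; split=> //; rewrite ltnNge; apply/negP => Ns'; apply: notlong.
by apply: long_path_leq Ns' _; exists s'.
Qed.

Lemma infinite_component A v :
  (forall N, long_path A N v) -> infinite_set (component G A v).
Proof.
move=> long /finite_seqP[r comp_r].
have [s [vs sr s_uniq]] := long (size r).
suff /(uniq_leq_size s_uniq) : {subset v :: s <= r} by rewrite /= sr ltnn.
move=> w /splitPl ws; have : component G A v w.
  case: ws vs => s1 s2 lasts1; rewrite cat_path => /andP[vs1 _].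
  by exists s1 => //; apply/walkP.
by rewrite comp_r.
Qed.

Lemma long_path_infinite A v : (forall N, finite_set (ball_vertices G v N)) ->
  infinite_set (component G A v) -> forall N, long_path A N v.
Proof.
move=> balls inf N; apply: contrapT => notlong; apply: inf.
apply: sub_finite_set (balls N) => w [s /walkP vs <-].
have [s' [vs' <- s'N]] := short_path notlong vs.
by exists s'; split=> //; [apply/walkP; apply: path_setT vs'|apply: ltnW].
Qed.

(** In a locally finite graph a component without a path of length [N] lies in
    a ball.  Conversely one of the two ends of [g] starts paths of unbounded
    lengths, and these have ever more vertices. *)
Lemma infinite_cluster_long_path A g : simple_graph G ->
  (forall v N, finite_set (ball_vertices G v N)) ->
  infinite_cluster G A g <-> forall N, on_long_path A N g.
Proof.
move=> simple balls; split=> [[Ag [v vg inf]] N|long].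
  by split=> //; exists v => //; apply: long_path_infinite.
have [x [y xy]] := simple.1 g; split; first by case: (long 0%N).
have [xlong|] := pselect (forall N, long_path A N x).
  by exists x; [exact: endpoints_incl xy|apply: infinite_component].
move=> /existsNP[N0 xN0]; exists y; first exact: endpoints_incr xy.
apply: infinite_component => N; have [_ [v]] := long (maxn N0 N).
case: (xy) => _ inc /inc[->|->].
  by move=> /(long_path_leq (leq_maxl _ _)).
exact: long_path_leq (leq_maxr _ _).
Qed.

(** This is what makes the event depend on finitely many edges. *)
Lemma on_long_path_ball A N g w : simple_graph G -> incV G w g ->
  on_long_path A N g -> on_long_path (A `&` ball_edges G w N.+1) N g.
Proof.
move=> simple wg [Ag [v vg [s [vs sN s_uniq]]]].
have ball_g : ball_edges G w 1 g.
  by apply: ball_edges_incident wg => //; apply: ball_vertices_center.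
split; first by split=> //; apply: ball_edges_mono ball_g.
exists v => //; exists s; split=> //.
have := path_in_ball simple (ball_g v vg) vs.
by rewrite sN add1n.
Qed.

End LongPaths.

(** * Edge traversals of a walk modulo 2 *)

Lemma addrr_F2 (x : 'F_2) : x + x = 0.
Proof. by apply: addrr_pchar2; rewrite pchar_Fp. Qed.

Section Crossings.
Variables (V E F : Type) (G : tiling V E F).
Implicit Types (u v w : V) (g h : E) (s : seq V).

(** The parity takes values in ['F_2] so that it can be added up linearly.  The
    definition makes sense for any sequence of vertices, since homotopies are
    not confined to walks. *)
Fixpoint crossings g s : 'F_2 :=
  if s is u :: s' then
    (if s' is v :: _ then `[< endpoints G g u v >]%:R else 0) + crossings g s'
  else 0.

Lemma crossings_cat g s u s' :
  crossings g (s ++ u :: s') = crossings g (rcons s u) + crossings g (u :: s').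
Proof.
elim: s => [|a [|b s] IHs] /=; first by rewrite !add0r.
  by rewrite addr0 addr0.
by rewrite -addrA; congr (_ + _); apply: IHs.
Qed.

Lemma crossings_rev g s : crossings g (rev s) = crossings g s.
Proof.
elim: s => // u [//|v s] IHs.
rewrite !rev_cons -!cats1 -catA crossings_cat -rev_cons IHs.
rewrite [LHS]addrC /= !addr0; congr ((nat_of_bool _)%:R + _).
by apply: asbool_equiv_eq; split => ends; apply: endpoints_sym.
Qed.

Lemma crossings_nth x0 g s : crossings g s =
  \sum_(i < (size s).-1) `[< endpoints G g (nth x0 s i) (nth x0 s i.+1) >]%:R.
Proof.
elim: s => [|u [|v s] IHs].
- by rewrite big_ord0.
- by rewrite big_ord0 /= addr0.
have -> : (size [:: u, v & s]).-1 = (size (v :: s)).-1.+1 by [].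
by rewrite big_ord_recl; congr (_ + _); apply: IHs.
Qed.

Hypothesis simple : simple_graph G.

Lemma crossings_boundary f n (v : 'I_n.+1 -> V) g : boundary_cycle G f v ->
  crossings g ([seq v i | i <- enum 'I_n.+1] ++ [:: v ord0]) = (incF G f g)%:R.
Proof.
move=> [e [v_inj e_inj inc ends]]; rewrite (crossings_nth (v ord0)).
rewrite size_cat size_map size_enum_ord addn1 /=.
transitivity (\sum_i (e i == g :> {classic E})%:R : 'F_2).
  apply: eq_bigr => i _; congr ((nat_of_bool _)%:R).
  have -> : nth (v ord0) ([seq v i | i <- enum 'I_n.+1] ++ [:: v ord0]) i = v i.
    rewrite nth_cat size_map size_enum_ord ltn_ord.
    by rewrite (nth_map ord0) ?size_enum_ord // nth_ord_enum.
  have -> : nth (v ord0) ([seq v i | i <- enum 'I_n.+1] ++ [:: v ord0]) i.+1 =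
            v (ordS i).
    rewrite nth_cat size_map size_enum_ord; case: ltnP => [lt_in|].
      rewrite (nth_map ord0) ?size_enum_ord //; congr v; apply: val_inj.
      by rewrite /= nth_enum_ord // modn_small.
    (* The last edge returns to v ord0, the term appended to the list. *)
    rewrite ltnS => le_ni; have in_eq : i = n :> nat.
      by apply/eqP; rewrite eqn_leq le_ni -ltnS ltn_ord.
    rewrite in_eq subnn /=; congr v; apply: val_inj; rewrite /= in_eq.
    by rewrite modnn.
  apply/asboolP/eqP => [gi|<-]; last exact: ends.
  exact: simple.2 (ends i) gi.
have [/inc[i <-]|notin] := boolP (incF G f g).
  rewrite (bigD1 i) //= eqxx big1 ?addr0 // => k ki.
  by case: eqP => // /e_inj eq_ki; rewrite eq_ki eqxx in ki.
rewrite big1 // => i _; case: eqP => // eq_ig; case/negP: notin.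
by apply/inc; exists i.
Qed.

(** A spur crosses its edge twice, and a turn around a face crosses each edge of
    that face once. *)
Lemma crossings_elementary_homotopy s s' : elementary_homotopy G s s' ->
  exists Y : seq F, forall g,
    crossings g s = crossings g s' + \sum_(f <- Y) (incF G f g)%:R.
Proof.
case=> [r u v r' _|r f n v r' bd].
  exists [::] => g; rewrite big_nil addr0 [LHS]crossings_cat [RHS]crossings_cat.
  congr (_ + _); rewrite /= addrA.
  have -> : `[< endpoints G g v u >] = `[< endpoints G g u v >].
    by apply: asbool_equiv_eq; split => ends; apply: endpoints_sym.
  by rewrite addrr_F2 add0r.
exists [:: f] => g; rewrite big_seq1 -(crossings_boundary _ bd).
have [c eq_c] : exists c, [seq v i | i <- enum 'I_n.+1] = v ord0 :: c.
  by rewrite enum_ordSl; eexists.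
rewrite {bd}eq_c [LHS]crossings_cat (crossings_cat _ r) -cat_cons.
rewrite (crossings_cat g (v ord0 :: c)) (cats1 (v ord0 :: c)).
by rewrite [LHS]addrA [LHS]addrAC.
Qed.

Lemma contractible_crossings u s : simply_connected G ->
  walk G setT u s -> last u s = u ->
  exists Y : seq F, forall g,
    crossings g (u :: s) = \sum_(f <- Y) (incF G f g)%:R.
Proof.
move=> sc us lasts; have := sc u s us lasts.
suff homotopic r r' :
    Relation_Operators.clos_refl_sym_trans _ (elementary_homotopy G) r r' ->
    exists Y : seq F, forall g,
      crossings g r = crossings g r' + \sum_(f <- Y) (incF G f g)%:R.
  by move=> /homotopic[Y crY]; exists Y => g; rewrite crY /= !add0r.
elim=> {u s us lasts r r'} [r r' /crossings_elementary_homotopy // | r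
  | r r' _ [Y crY] | r r' r'' _ [Y crY] _ [Y' crY']].
- by exists [::] => g; rewrite big_nil addr0.
- by exists Y => g; rewrite crY -addrA addrr_F2 addr0.
- by exists (Y' ++ Y) => g; rewrite crY crY' big_cat addrA.
Qed.

End Crossings.

(** * Charts from a finite tiling to the planar one *)

Lemma card_eq_finset (T : finType) (A : {set T}) n :
  ([set x | x \in A] #= `I_n)%card -> #|A| = n.
Proof.
move=> An; apply/card_eq_II; rewrite -(card_eqr An) card_eq_sym.
apply/card_set_bijP; exists (fun x => index x (enum A)); split.
- by move=> x xA; rewrite /= cardE index_mem mem_enum.
- move=> x y; rewrite !inE /= => xA yA eq_index.
  rewrite -[LHS](@nth_index _ x _ (enum A)) ?mem_enum // eq_index.
  by rewrite nth_index ?mem_enum.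
- move=> i; rewrite /= cardE => ltiA; have [x0 _] : exists x0, x0 \in A.
    by apply/set0Pn; rewrite -card_gt0 cardE (leq_ltn_trans _ ltiA).
  exists (nth x0 (enum A) i); last by rewrite index_uniq // enum_uniq.
  by rewrite /= -mem_enum mem_nth.
Qed.

Section Charts.
Variables (VH EH FH : finType) (V : eqType) (E F : Type).
Variables (H : tiling VH EH FH) (G : tiling V E F).

(** An identification of the ball of radius [t] around [r] in [H] with the ball
    of radius [t] around [w] in [G], which takes [r] to [w].  The predicates
    [DV] and [DE] delimit the part of [H] on which the maps are meaningful. *)
Record chart (t : nat) (r : VH) (w : V) (fV : VH -> V) (fE : EH -> E)
    (DV : set VH) (DE : set EH) : Prop := {
  chart_center : fV r = w ;
  chart_injV : forall a b, DV a -> DV b -> fV a = fV b -> a = b ;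
  chart_injE : forall g h, DE g -> DE h -> fE g = fE h -> g = h ;
  chart_incident : forall g a, DE g -> incV H a g -> DV a ;
  chart_endpoints : forall g a b, DE g -> DV a -> DV b ->
    endpoints H g a b <-> endpoints G (fE g) (fV a) (fV b) ;
  chart_walk : forall s, path (adjb H setT) r s -> (size s <= t)%N ->
    (forall a, a \in r :: s -> DV a) /\ path (adjb H DE) r s ;
  chart_face : forall f', ball_faces G w t f' -> exists f,
    forall g, incF H f g = `[< DE g >] && incF G f' (fE g) }.

Hypothesis simpleG : simple_graph G.

(** Charts at one vertex are moved to other vertices by the symmetries of the
    finite tiling. *)
Lemma chart_iso t r w fV fE DV DE hV hE hF r' :
  tiling_iso H H hV hE hF -> hV r' = r -> chart t r w fV fE DV DE ->
  chart t r' w (fV \o hV) (fE \o hE) (hV @^-1` DV) (hE @^-1` DE).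
Proof.
move=> [hVb hEb hFb incVh incFh] hr [cr cV cE cinc cends cwalk cface].
have hends g a b : endpoints H (hE g) (hV a) (hV b) <-> endpoints H g a b.
  split=> -[neq inc]; split.
  - by move=> eqab; apply: neq; rewrite eqab.
  - move=> c; rewrite -incVh inc; split=> -[].
    + by move/(bij_inj hVb); left.
    + by move/(bij_inj hVb); right.
    + by move=> ->; left.
    + by move=> ->; right.
  - by move/(bij_inj hVb).
  - case: hVb => kV hVK kVK c; rewrite -{1}[c]kVK incVh inc; split=> -[].
    + by move=> <-; rewrite kVK; left.
    + by move=> <-; rewrite kVK; right.
    + by move=> ->; rewrite hVK; left.
    + by move=> ->; rewrite hVK; right.
have hadj D a b : adjb H D (hV a) (hV b) -> adjb H (hE @^-1` D) a b.
  move=> /asboolP[g Dg ab]; case: hEb => kE hEK kEK.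
  apply/asboolP; exists (kE g); rewrite /= ?kEK //.
  by apply/hends; rewrite kEK.
split=> /=.
- by rewrite hr.
- by move=> a b Da Db /(cV _ _ Da Db)/(bij_inj hVb).
- by move=> a b Da Db /(cE _ _ Da Db)/(bij_inj hEb).
- by move=> g a Dg ag; apply: (cinc _ _ Dg); rewrite incVh.
- move=> g a b Dg Da Db.
  exact: iff_trans (iff_sym (hends _ _ _)) (cends _ _ _ Dg Da Db).
- move=> s r's st; have : path (adjb H setT) r (map hV s).
    rewrite -hr; apply: homo_path r's => a b /asboolP[g _ ab].
    by apply/asboolP; exists (hE g) => //; apply/hends.
  move=> /cwalk; rewrite size_map => /(_ st)[Ds rs]; split.
    by move=> a /(map_f hV) /= ha; apply: Ds; rewrite -hr.
  move: rs; rewrite -hr path_map; apply: sub_path => a b; exact: hadj.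
- move=> f' /cface[f incf]; case: hFb => kF hFK kFK; exists (kF f) => g.
  by rewrite -incFh kFK incf.
Qed.

Variable m : nat.
Hypotheses (regH : regular H m) (regG : regular G m).

(** The isomorphism of balls need not match the centres.  The preimage [r] of
    [w] is the right centre: a walk from [r] cannot leave the domain before
    its image leaves the ball of [w], since wherever all [m] edges at the
    image of a vertex lie in the ball, they are the images of [m] edges at
    that vertex, and these are all its edges. *)
Lemma chart_exists t u w : isomorphic_balls H u G w t ->
  exists r fV fE DV DE, [/\ chart t r w fV fE DV DE &
    forall g, ball_edges G w t g -> exists2 h, DE h & fE h = g].
Proof.
move=> [fV [fE [fF [[[Vto Vinj Vsurj] [Eto Einj Esurj] [Fto Finj Fsurj]]]]]].
set DV := ball_vertices H u t; set DE := ball_edges H u t => incVf incFf.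
have [r Dr rw] := Vsurj w (ball_vertices_center G w t).
have injV a b : DV a -> DV b -> fV a = fV b -> a = b.
  by move=> Da Db; apply: Vinj; apply/mem_set.
have injE g h : DE g -> DE h -> fE g = fE h -> g = h.
  by move=> Dg Dh; apply: Einj; apply/mem_set.
exists r, fV, fE, DV, DE; split=> //.
split=> //.
- by move=> g a Dg; apply: Dg.
- move=> g a b Dg Da Db; split=> -[neq inc]; split.
  + by move/injV => /(_ Da Db).
  + move=> c; split=> [cg|[]->]; last 2 first.
    * by rewrite incVf //; apply/inc; left.
    * by rewrite incVf //; apply/inc; right.
    have [c' Dc' ec] := Vsurj c (Eto _ Dg _ cg).
    by move: cg; rewrite -ec incVf // => /inc[->|->]; [left|right].
  + by move=> eqab; apply: neq; rewrite eqab.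
  + move=> c; split=> [cg|[]->]; last 2 first.
    * by rewrite -incVf //; apply/inc; left.
    * by rewrite -incVf //; apply/inc; right.
    have Dc := Dg _ cg.
    by move: cg; rewrite -incVf // => /inc[/injV->|/injV->] //; [left|right].
- have full a : DV a -> (forall h, incV G (fV a) h -> ball_edges G w t h) ->
      forall g, incV H a g -> DE g.
    move=> Da ball_a g ag.
    pose S := [set g | incV H a g]%SET.
    pose S' := [set g | incV H a g && `[< DE g >]]%SET.
    have cardS : #|S| = m.
      apply: card_eq_finset; have -> : [set h | h \in S] = [set h | incV H a h].
        by apply/seteqP; split=> h; rewrite /= inE.
      exact: regH.
    have imS' : fE @` [set g | g \in S'] = [set h | incV G (fV a) h].
      apply/seteqP; split=> [x [h /= hS' <-]|h /= ah].
        by move: hS'; rewrite inE => /andP[ah /asboolP Dh]; rewrite incVf.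
      have [h' Dh' eh] := Esurj h (ball_a h ah).
      exists h' => //=; rewrite inE -incVf // eh ah.
      exact/asboolP.
    have cardS' : #|S'| = m.
      apply: card_eq_finset; rewrite -(card_eql (inj_card_eq (f := fE) _)).
        by rewrite imS'; apply: regG.
      move=> h h' /set_mem/= hS' /set_mem/= h'S'; move: hS' h'S'.
      rewrite !inE => /andP[_ /asboolP Dh] /andP[_ /asboolP Dh'].
      exact: injE.
    (* All m edges at a lie in the domain, since m of them do. *)
    have : S' == S.
      rewrite eqEcard cardS cardS' leqnn andbT.
      by apply/fintype.subsetP => h; rewrite !inE => /andP[].
    by move=> /eqP/setP/(_ g); rewrite !inE ag => /asboolP.
  move=> s rs st.
  suff [Ds rsE _] : [/\ forall a, a \in r :: s -> DV a, path (adjb H DE) r s &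
      ball_vertices G w (size s) (fV (last r s))] by [].
  elim/last_ind: s rs st => [|s b IHs] /=.
    move=> _ _; split=> //; last by rewrite rw; apply: ball_vertices_center.
    by move=> a; rewrite inE => /eqP->.
  rewrite rcons_path size_rcons last_rcons => /andP[rs sb] st.
  have [Ds rsE ballw] := IHs rs (ltnW st).
  have Dlast : DV (last r s) by apply: Ds; apply: mem_last.
  move/asboolP: sb => [g _ endsg].
  have Dg : DE g.
    apply: (full _ Dlast) (endpoints_incl endsg) => h ah.
    by apply: ball_edges_mono st _ _; apply: ball_edges_incident ah.
  have Db : DV b by apply: Dg; apply: endpoints_incr endsg.
  split; first last.
  - have image : incV G (fV (last r s)) (fE g).
      by rewrite incVf //; apply: endpoints_incl endsg.
    apply: (ball_edges_incident simpleG ballw image).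
    by rewrite incVf //; apply: endpoints_incr endsg.
  - by rewrite rcons_path rsE; apply/asboolP; exists g.
  - move=> a; rewrite -rcons_cons mem_rcons inE => /orP[/eqP->//|].
    exact: Ds.
- move=> f' /Fsurj[f Df <-]; exists f => g.
  case: asboolP => [Dg|nDg] /=; first by rewrite incFf.
  by apply/negbTE/negP => /Df.
Qed.

End Charts.

(** * Transport along a chart *)

Lemma uniform_bound (T : finType) (Q : T -> nat -> Prop) :
  (forall x k k', (k <= k')%N -> Q x k -> Q x k') ->
  (forall x, exists k, Q x k) -> exists k, forall x, Q x k.
Proof.
move=> Q_mono /choice[k Qk]; exists (\max_x k x) => x.
exact: Q_mono (leq_bigmax x) (Qk x).
Qed.

Section ChartTransport.
Variables (VH EH FH : finType) (V : eqType) (E F : Type).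
Variables (H : tiling VH EH FH) (G : tiling V E F).
Variables (t : nat) (r : VH) (w : V) (fV : VH -> V) (fE : EH -> E).
Variables (DV : set VH) (DE : set EH).
Hypotheses (simpleH : simple_graph H) (simpleG : simple_graph G).
Hypothesis chartHG : chart H G t r w fV fE DV DE.

(** Outside the chart there is nothing to cross: in a simple graph the edge
    between two successive vertices of the walk is the one in the chart. *)
Lemma chart_crossings s g : path (adjb H setT) r s -> (size s <= t)%N ->
  crossings H g (r :: s) =
  if `[< DE g >] then crossings G (fE g) (map fV (r :: s)) else 0.
Proof.
move=> rs st; have [] := chart_walk chartHG rs st.
elim: s (r) {rs st} => [|b s IHs] a /=; first by rewrite addr0 if_same.
move=> Ds /andP[ab bs].
have Da : DV a by apply: Ds; rewrite mem_head.
have Db : DV b by apply: Ds; rewrite in_cons mem_head orbT.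
rewrite [X in _ + X](IHs b) //=; last first.
  by move=> c cs; apply: Ds; rewrite in_cons cs orbT.
move/asboolP: ab => [h Dh abh].
case: (asboolP (DE g)) => Dg.
  by rewrite (asbool_equiv_eq (chart_endpoints chartHG Dg Da Db)).
case: asboolP => [abg|_]; last by rewrite addr0.
by case: Dg; rewrite (simpleH.2 _ _ _ _ abg abh).
Qed.

(** The edges of a short closed walk bound, modulo 2, a set of faces as soon
    as its image does: pull the faces back. *)
Lemma chart_boundary s (Y : seq F) :
  path (adjb H setT) r s -> (size s <= t)%N ->
  (forall i, (i < size Y)%N -> forall f0, ball_faces G w t (nth f0 Y i)) ->
  (forall g, crossings G g (map fV (r :: s)) =
             \sum_(f <- Y) (incF G f g)%:R) ->
  exists Y' : seq FH, forall g,
    crossings H g (r :: s) = \sum_(f <- Y') (incF H f g)%:R.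
Proof.
move=> rs st Yball crY.
have [Y' eqY'] : exists Y' : seq FH, forall g,
    \sum_(f <- Y') (incF H f g)%:R =
    if `[< DE g >] then \sum_(f <- Y) (incF G f (fE g))%:R else 0 :> 'F_2.
  elim: Y Yball {crY} => [_|f Y IHY Yball].
    by exists [::] => g; rewrite !big_nil if_same.
  have [i iY f0|Y' eqY'] := IHY; first exact: (Yball i.+1).
  have [f' incf'] := chart_face chartHG (Yball 0%N isT f).
  exists (f' :: Y') => g; rewrite !big_cons eqY' incf'.
  by case: asboolP; rewrite ?addr0.
by exists Y' => g; rewrite chart_crossings // eqY' crY.
Qed.

Lemma chart_incident_center g : DE g -> incV G w (fE g) -> incV H r g.
Proof.
move=> Dg; have [x [y xy]] := simpleH.1 g.
have Dx := chart_incident chartHG Dg (endpoints_incl xy).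
have Dy := chart_incident chartHG Dg (endpoints_incr xy).
have [D _] := chart_walk chartHG (s := [::]) isT (leq0n _).
have Dr : DV r by apply: D; rewrite mem_head.
have [_ inc] := (chart_endpoints chartHG Dg Dx Dy).1 xy.
rewrite -(chart_center chartHG) => /inc[/(chart_injV chartHG Dr)->|
  /(chart_injV chartHG Dr)->] //; first exact: endpoints_incl xy.
exact: endpoints_incr xy.
Qed.

Lemma chart_path A a s : (forall b, b \in a :: s -> DV b) ->
  path (adjb H (A `&` DE)) a s ->
  path (adjb G (fE @` (A `&` DE))) (fV a) (map fV s).
Proof.
elim: s a => //= b s IHs a Ds /andP[/asboolP[g ADg ab] bs]; apply/andP; split.
  apply/asboolP; exists (fE g); first by exists g.
  apply/(chart_endpoints chartHG) => //; first exact: ADg.2.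
    by apply: Ds; rewrite mem_head.
  by apply: Ds; rewrite in_cons mem_head orbT.
by apply: IHs => // c cs; apply: Ds; rewrite in_cons cs orbT.
Qed.

(** The bound [N < t] leaves room for the step from [r] to the other end of
    [g], from which the long path may start. *)
Lemma chart_long_path A N g : incV H r g -> (N < t)%N ->
  on_long_path H A N g -> DE g /\ on_long_path G (fE @` (A `&` DE)) N (fE g).
Proof.
move=> rg Nt [Ag [v vg [s [vs sN s_uniq]]]].
have [x rx] := incV_endpoints simpleH rg.
have Dadj b : endpoints H g r b -> DV b /\ DE g.
  move=> rb; have radj : adjb H setT r b by apply/asboolP; exists g.
  have [] := chart_walk chartHG (s := [:: b]).
  - by rewrite /= radj.
  - exact: leq_trans Nt.
  move=> Dr /=; rewrite andbT => /asboolP[h Dh rbh].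
  split; first by apply: Dr; rewrite in_cons mem_head orbT.
  by rewrite (simpleH.2 _ _ _ _ rb rbh).
have [_ Dg] := Dadj x rx.
have rsT := path_setT vs.
have [Ds vsD] : (forall b, b \in v :: s -> DV b) /\ path (adjb H DE) v s.
  case: (rx) => _ inc; move/inc: vg => [ev|ev]; rewrite ev in rsT *.
    by apply: (chart_walk chartHG) => //; rewrite sN ltnW.
  have [] := chart_walk chartHG (s := x :: s).
  - by rewrite /= rsT andbT; apply/asboolP; exists g.
  - by rewrite /= sN.
  move=> Ds /= /andP[_ ->]; split=> // b bs; apply: Ds.
  by rewrite in_cons bs orbT.
have Dv : DV v by apply: Ds; rewrite mem_head.
split=> //; split; first by exists g.
exists (fV v).
  have [y vy] := incV_endpoints simpleH vg.
  have Dy : DV y.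
    case: (rx) => _ inc; have /inc[->|->] := endpoints_incr vy; last first.
      by case: (Dadj x rx).
    have [] := chart_walk chartHG (s := [::]) isT (leq0n _).
    by move=> D _; apply: D; rewrite mem_head.
  exact: endpoints_incl ((chart_endpoints chartHG Dg Dv Dy).1 vy).
exists (map fV s); split.
- exact: chart_path Ds (path_setI simpleH vs vsD).
- by rewrite size_map.
- rewrite -map_cons map_inj_in_uniq // => b c /Ds Db /Ds Dc.
  exact: (chart_injV chartHG Db Dc).
Qed.

End ChartTransport.

Section UniformRadius.
Variables (V : eqType) (E F : Type) (G : tiling V E F) (w : V).
Hypothesis simple : simple_graph G.
Hypothesis connected : connected_graph G.
Hypothesis face_cycle :
  forall f, exists n (v : 'I_n -> V), boundary_cycle G f v.
Hypothesis sc : simply_connected G.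
Hypothesis finite_balls : forall k, finite_set (ball_vertices G w k).

Lemma face_in_ball f : exists k, ball_faces G w k f.
Proof.
have [n [v [e [_ _ inc ends]]]] := face_cycle f.
have [k ballk] : exists k, forall i, ball_vertices G w k (v i).
  apply: uniform_bound => [i k k' kk'|i]; first exact: ball_vertices_mono.
  by have [s ws lasts] := connected w (v i); exists (size s), s.
exists k => g /inc[i <-] c.
by case: (ends i) => _ endsi /endsi[->|->]; apply: ballk.
Qed.

(** There are only finitely many closed walks of bounded length at [w], so the
    faces they bound all lie in one ball. *)
Lemma short_closed_walks_bound L : exists k, forall s,
  path (adjb G setT) w s -> (size s <= L)%N -> last w s = w ->
  exists Y : seq F,
    (forall i, (i < size Y)%N -> forall f0, ball_faces G w k (nth f0 Y i)) /\
    (forall g, crossings G g (w :: s) = \sum_(f <- Y) (incF G f g)%:R).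
Proof.
have /finite_seqP[b eqb] := finite_balls L.
pose vertex (i : 'I_(size b)) := nth w b i.
pose walk_of (z : {bseq L of 'I_(size b)}) : seq V := map vertex z.
pose good k s := exists Y : seq F,
  (forall i, (i < size Y)%N -> forall f0, ball_faces G w k (nth f0 Y i)) /\
  (forall g, crossings G g (w :: s) = \sum_(f <- Y) (incF G f g)%:R).
have [k goodk] : exists k, forall z, path (adjb G setT) w (walk_of z) ->
    last w (walk_of z) = w -> good k (walk_of z).
  apply: uniform_bound => [z k k' kk' zk wz lastz|z].
    have [Y [Yk crY]] := zk wz lastz; exists Y; split=> // i iY f0.
    exact: ball_faces_mono kk' _ (Yk i iY f0).
  have [/walkP wz|] := boolP (path (adjb G setT) w (walk_of z)); last first.
    by exists 0%N.
  have [lastz|] := pselect (last w (walk_of z) = w); last by exists 0%N.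
  have [Y crY] := contractible_crossings simple sc wz lastz.
  have [k Yk] : exists k, forall i : 'I_(size Y), forall f0,
      ball_faces G w k (nth f0 Y i).
    apply: uniform_bound => [i k k' kk' ik f0|i].
      exact: ball_faces_mono kk' _ (ik f0).
    case: Y {crY} i => [|f Y] i; first by case: i.
    have [k fk] := face_in_ball (nth f (f :: Y) i); exists k => f0.
    by rewrite (set_nth_default f).
  exists k => _ _; exists Y; split=> // i iY f0.
  exact: (Yk (Ordinal iY)).
exists k => s ws sL lasts.
have sb : {subset s <= b}.
  move=> v vs; have /splitPl vws : v \in w :: s by rewrite in_cons vs orbT.
  have : ball_vertices G w L v; last by rewrite eqb.
  case: vws ws sL {vs lasts} => s1 s2 lasts1.
  rewrite cat_path size_cat => /andP[ws1 _] sL; exists s1; split=> //.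
    exact/walkP.
  exact: leq_trans (leq_addr _ _) sL.
have [z eqz] : exists z, map vertex z = s.
  elim: s sb {ws sL lasts} => [_|v s IHs sb]; first by exists [::].
  have [x xs|z eqz] := IHs; first by apply: sb; rewrite in_cons xs orbT.
  have vb : (index v b < size b)%N by rewrite index_mem sb ?mem_head.
  by exists (Ordinal vb :: z); rewrite /= eqz /vertex nth_index ?sb ?mem_head.
have zL : (size z <= L)%N by rewrite -(size_map vertex) eqz.
by have := goodk (Bseq zL); rewrite /walk_of /= eqz; apply.
Qed.

End UniformRadius.

(** * Cycles and boundaries of a finite tiling *)

Section CyclesAndBoundaries.
Variables (V E F : finType) (H : tiling V E F).
Hypothesis simple : simple_graph H.

Definition edge_vertex_mx : 'M['F_2]_(#|E|, #|V|) :=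
  \matrix_(i, j) (incV H (enum_val j : V) (enum_val i : E))%:R.

Definition face_edge_mx : 'M['F_2]_(#|F|, #|E|) :=
  \matrix_(i, j) (incF H (enum_val i : F) (enum_val j : E))%:R.

Lemma crossings_rcons g u s v : crossings H g (rcons (u :: s) v) =
  crossings H g (u :: s) + `[< endpoints H g (last u s) v >]%:R.
Proof.
rewrite lastI -cats1 cat_rcons crossings_cat; congr (_ + _).
by rewrite /= !addr0.
Qed.

Lemma crossings_rev_cat g u s v s' :
  crossings H g (u :: s ++ rev (v :: s')) =
  `[< endpoints H g (last u s) (last v s') >]%:R
    + crossings H g (u :: s) + crossings H g (v :: s').
Proof.
rewrite -(crossings_rev _ g (v :: s')) (lastI v) rev_rcons -cat_cons.
by rewrite crossings_cat crossings_rcons [in RHS](addrC _%:R).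
Qed.

Lemma endpoints_sum (M : lmodType 'F_2) g a b (c : V -> M) :
  endpoints H g a b -> c a + c b = \sum_v (incV H v g)%:R *: c v.
Proof.
move=> [neq inc]; rewrite (bigD1 a) //= (bigD1 b) /=; last first.
  by apply/eqP => eqba; apply: neq.
have -> : incV H a g by apply/inc; left.
have -> : incV H b g by apply/inc; right.
rewrite !scale1r big1 ?addr0 // => v /andP[va vb].
case: (boolP (incV H v g)) => [/inc[] eqv|_]; last by rewrite scale0r.
  by rewrite eqv eqxx in va.
by rewrite eqv eqxx in vb.
Qed.

Variables (eps : {set E}) (N : nat).
Let open_edges : set E := [set g | g \in eps].

Hypothesis short_closed_walk : forall u s,
  path (adjb H setT) u s -> (size s <= N + N)%N -> last u s = u ->
  exists Y : seq F, forall g,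
    crossings H g (u :: s) = \sum_(f <- Y) (incF H f g)%:R.

Definition long_path_edges : {set E} :=
  [set g | `[< on_long_path H open_edges N g >]]%SET.

Lemma long_path_edges_sub : long_path_edges \subset eps.
Proof. by apply/fintype.subsetP => g; rewrite inE => /asboolP[]. Qed.

(** In a component containing a vertex without long paths, that vertex is
    joined to all others by short walks.  An edge of a cycle closes
    up with the walks to its ends to a short closed walk, hence to a boundary;
    adding these up over the cycle, the walks cancel because every vertex has
    even degree.  In the other components all edges are on long paths. *)
Lemma cycle_sub_boundary :
  (select _ eps :&: kermx edge_vertex_mx
     <= face_edge_mx + select _ long_path_edges)%MS.
Proof.
pose e := adjb H open_edges.
have e_sym : connect_sym e by apply: sym_connect_sym; apply: adjb_sym.
have [a [b ab]] : exists a b : E -> V, forall g, endpoints H g (a g) (b g).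
  have /choice[ab abP] : forall g, exists p, endpoints H g p.1 p.2.
    by move=> g; have [x [y xy]] := simple.1 g; exists (x, y).
  by exists (fst \o ab), (snd \o ab).
(* The root depends on the component only, hence agrees at both ends of g. *)
pose root v := [pick u | connect e v u && ~~ `[< long_path H open_edges N u >]].
have /choice[gam gamP] : forall v, exists s, forall u, root v = Some u ->
    [/\ path e u s, last u s = v & (size s < N)%N].
  move=> v.
  rewrite /root; case: pickP => [u /andP[vu /asboolPn short]|_]; last first.
    by exists [::].
  move: vu; rewrite e_sym => /connectP[s us lasts].
  have [s' [us' lasts' s'N]] := short_path short us.
  by exists s' => _ [<-]; rewrite lasts' lasts.
pose c v : 'rV['F_2]_#|E| :=
  if root v is Some u then \row_j crossings H (enum_val j) (u :: gam v) else 0.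
have closed_up g : g \in eps ->
    ((delta_mx 0 (enum_rank g) + (c (a g) + c (b g)))%R
      <= face_edge_mx + select _ long_path_edges)%MS.
  move=> geps; have eab : e (a g) (b g) by apply/asboolP; exists g.
  have rootb : root (b g) = root (a g).
    by apply: eq_pick => u; rewrite (same_connect e_sym (connect1 eab)).
  rewrite /c rootb; case root_a : (root (a g)) => [u|]; last first.
    rewrite !addr0; apply: submx_trans (addsmxSr _ _); apply/sub_selectP => i h.
    apply: contraNeq; rewrite mxE (inj_eq enum_rank_inj).
    have [->|_] := eqVneq h g; last by rewrite andbF eqxx.
    move=> _.
    rewrite inE; apply/asboolP; split=> //; exists (a g).
      exact: endpoints_incl (ab g).
    move: root_a; rewrite /root; case: pickP => // /(_ (a g)).
    by rewrite connect0 /= => /negbFE/asboolP.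
  have [ua lasta sa] := gamP _ _ root_a.
  rewrite -rootb in root_a; have [ub lastb sb] := gamP _ _ root_a.
  apply: submx_trans (addsmxSl _ _).
  have [||| Y crY] := @short_closed_walk u (gam (a g) ++ rev (u :: gam (b g))).
  - rewrite cat_path (path_setT ua) lasta lastI rev_rcons lastb /=.
    apply/andP; split; first by apply/asboolP; exists g.
    rewrite -{1}lastb rev_path; apply: sub_path (path_setT ub) => x y.
    by rewrite adjb_sym.
  - by rewrite size_cat size_rev /= addnC leq_add // ltnW.
  - by rewrite last_cat rev_cons last_rcons.
  have -> : delta_mx 0 (enum_rank g) +
      (\row_j crossings H (enum_val j) (u :: gam (a g)) +
       \row_j crossings H (enum_val j) (u :: gam (b g))) =
      \sum_(f <- Y) row (enum_rank f) face_edge_mx.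
    apply/matrixP => i j; rewrite !mxE summxE.
    rewrite (eq_bigr (fun f => (incF H f (enum_val j))%:R)); last first.
      by move=> f _; rewrite !mxE enum_rankK.
    rewrite -crY crossings_rev_cat lasta lastb.
    have -> : `[< endpoints H (enum_val j) (a g) (b g) >] =
              (i == 0) && (j == enum_rank g); last by rewrite [LHS]addrA.
    rewrite ord1 eqxx /=; apply/asboolP/eqP => [abj|->]; last first.
      by rewrite enum_rankK.
    by rewrite (simple.2 _ _ _ _ (ab g) abj) enum_valK.
  by apply: summx_sub => f _; apply: row_sub.
apply/rV_subP => x; rewrite sub_capmx.
move=> /andP[/sub_selectP x_eps /sub_kermxP xA].
(* Each c v occurs once for every edge of the cycle at v: an even number. *)
have ends_cancel :
    \sum_j x 0 j *: (c (a (enum_val j)) + c (b (enum_val j))) = 0.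
  under eq_bigr => j _.
    rewrite (endpoints_sum _ (ab (enum_val j))) scaler_sumr; over.
  rewrite /=.
  rewrite exchange_big /= big1 // => v _.
  under eq_bigr => j _ do rewrite scalerA.
  rewrite -scaler_suml; have /matrixP/(_ 0 (enum_rank v)) := xA.
  rewrite !mxE; under eq_bigr => j _ do rewrite mxE enum_rankK.
  by move=> ->; rewrite scale0r.
have -> : x = \sum_j x 0 j *: (delta_mx 0 (enum_rank (enum_val j : E))
    + (c (a (enum_val j)) + c (b (enum_val j)))).
  under eq_bigr => j _ do rewrite scalerDr.
  rewrite big_split /= ends_cancel addr0 {1}[x]row_sum_delta.
  by apply: eq_bigr => j _; rewrite enum_valK.
apply: summx_sub => j _; have [jeps|jeps] := boolP ((enum_val j : E) \in eps).
  by apply: scalemx_sub; apply: closed_up.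
by have := x_eps 0 _ jeps; rewrite enum_valK => ->; rewrite scale0r sub0mx.
Qed.

End CyclesAndBoundaries.

Section RankDifference.
Variables (V E F : finType) (H : tiling V E F).

Lemma subgraph_rankE (eps : {set E}) :
  subgraph_rank H eps = \rank (select _ eps *m edge_vertex_mx H).
Proof.
rewrite -mxrank_tr trmx_mul mulmx_selectT /subgraph_rank; congr (\rank _).
by apply/matrixP => i j; rewrite !mxE enum_rankK.
Qed.

Lemma subgraph_rank_dualE (eps : {set E}) :
  subgraph_rank (dual H) eps = \rank (face_edge_mx H *m (select _ eps)^T).
Proof.
rewrite mulmx_selectT /subgraph_rank; congr (\rank _).
by apply/matrixP => i j; rewrite !mxE enum_rankK.
Qed.

(** Boundaries are cycles: the edges around a face that meet a given vertex come
    in pairs. *)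
Lemma face_edge_vertex_mx : is_tiling H ->
  face_edge_mx H *m edge_vertex_mx H = 0.
Proof.
move=> [simple _ face_cycle _]; apply/matrixP => i j; rewrite !mxE.
set f : F := enum_val i; set v : V := enum_val j.
have [n [w [e [w_inj e_inj inc ends]]]] := face_cycle f.
transitivity (\sum_g ((incF H f g)%:R * (incV H v g)%:R : 'F_2)).
  rewrite (reindex (enum_rank : E -> _)) /=.
    by apply: eq_bigr => g _; rewrite !mxE enum_rankK.
  by exists enum_val => g _; rewrite ?enum_rankK ?enum_valK.
rewrite (bigID (mem (e @: [set: 'I_n])%SET)) /=.
rewrite [X in _ + X]big1 ?addr0; last first.
  move=> g; case: (boolP (incF H f g)) => [/inc[k <-]|_ _]; last first.
    by rewrite mul0r.
  by rewrite imset_f ?finset.in_setT.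
rewrite big_imset /=; last by move=> x y _ _; apply: e_inj.
rewrite (eq_bigl xpredT) => [|k]; last by rewrite finset.in_setT.
(* Both halves of this sum count the occurrences of v on the cycle. *)
transitivity (\sum_k ((w k == v)%:R + (w (ordS k) == v)%:R : 'F_2)).
  apply: eq_bigr => k _; have -> : incF H f (e k) by apply/inc; exists k.
  rewrite mul1r; have [neq endk] := ends k.
  case: (boolP (incV H v (e k))) => [/endk[->|->]|vk].
  - by rewrite eqxx; case: eqP => [/esym //|_]; rewrite addr0.
  - by rewrite eqxx; case: eqP => [//|_]; rewrite add0r.
  - case: eqP => [wv|_]; first by case/negP: vk; apply/endk; left.
    case: eqP => [wv|_]; first by case/negP: vk; apply/endk; right.
    by rewrite addr0.
rewrite big_split /= [X in X + _](reindex_inj (bij_inj (ordS_bij n))).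
exact: addrr_F2.
Qed.

End RankDifference.

(** * Bounds on the mean rank difference *)

Section FiniteTilingBounds.
Variables (V E F : finType) (H : tiling V E F).

Lemma regular_double_count m : simple_graph H -> regular H m ->
  (m * #|V| = 2 * #|E|)%N.
Proof.
move=> simple reg.
have degree v : \sum_(g | incV H v g) 1 = m :> nat.
  rewrite -(card_eq_finset (A := [set g | incV H v g]%SET) (n := m)).
    by rewrite -sum1_card; apply: eq_bigl => g; rewrite inE.
  rewrite (_ : [set g | _] = [set g | incV H v g]); first exact: reg.
  by apply/seteqP; split=> g; rewrite /= inE.
have ends g : \sum_(v | incV H v g) 1 = 2 :> nat.
  have [x [y [neq inc]]] := simple.1 g.
  transitivity #|[set x; y]%SET|; last by rewrite cards2; case: eqP.
  rewrite -sum1_card; apply: eq_bigl => v; rewrite !inE.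
  apply/idP/orP; first by move/inc => [->|->]; [left|right].
  by move=> [/eqP ->|/eqP ->]; apply/inc; [left|right].
have : (\sum_v \sum_(g | incV H v g) 1 = \sum_g \sum_(v | incV H v g) 1)%N.
  by rewrite (exchange_big_dep xpredT).
rewrite (eq_bigr (fun=> m)) // [in RHS](eq_bigr (fun=> 2%N)) //.
by rewrite !sum_nat_const !(mulnC #|_|).
Qed.

(** A set of faces without boundary is a union of components of the dual. *)
Lemma rank_face_edge_mx : simple_graph (dual H) -> connected_graph (dual H) ->
  (#|F| <= (\rank (face_edge_mx H)).+1)%N.
Proof.
move=> simple connected; suff : (\rank (kermx (face_edge_mx H)) <= 1)%N.
  by rewrite mxrank_ker leq_subLR addn1.
suff sub1 : (kermx (face_edge_mx H) <= (const_mx 1 : 'rV['F_2]_#|F|))%MS.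
  exact: leq_trans (mxrankS sub1) (rank_leq_row _).
apply/rV_subP => y /sub_kermxP yB.
have [f0 _|F0] := pickP (fun _ : F => true); last first.
  have -> : y = 0; last exact: sub0mx.
  by apply/rowP => i; have := F0 (enum_val i).
suff const f : y 0 (enum_rank f) = y 0 (enum_rank f0).
  have -> : y = y 0 (enum_rank f0) *: const_mx 1.
    by apply/rowP => i; rewrite !mxE mulr1 -(const (enum_val i)) enum_valK.
  exact: scalemx_sub.
have [s] := connected f0 f.
elim: s f0 => [|f2 s IHs] f1 /=; first by move=> _ ->.
move=> [[g _ ends] f2s] lasts; rewrite (IHs f2 f2s lasts).
have /rowP/(_ (enum_rank g)) := yB; rewrite mxE.
transitivity (y 0 (enum_rank f1)
  + (y 0 (enum_rank f1) + y 0 (enum_rank f2))); last first.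
  rewrite (endpoints_sum (fun f => y 0 (enum_rank f) : ('F_2)^o) ends).
  rewrite -[RHS]addr0; congr (_ + _).
  have /rowP/(_ (enum_rank g)) := yB; rewrite !mxE => yBg; rewrite -[RHS]yBg.
  rewrite [RHS](reindex (enum_rank : F -> _)) /=.
    by apply: eq_bigr => h _; rewrite mxE !enum_rankK mulrC.
  by exists enum_val => h _; rewrite ?enum_rankK ?enum_valK.
by rewrite addrA addrr_F2 add0r.
Qed.

Lemma connected_iso (V' E' F' : Type) (H' : tiling V' E' F') fV fE fF :
  tiling_iso H H' fV fE fF -> connected_graph H -> connected_graph H'.
Proof.
move=> [[kV fVK kVK] [kE fEK kEK] _ inc _] connected u v.
have [s /walkP us lasts] := connected (kV u) (kV v).
exists (map fV s); last by rewrite -[u in LHS]kVK last_map lasts kVK.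
apply/walkP; rewrite -[u]kVK; apply: homo_path us => x y.
move=> /asboolP[g _ [neq incg]]; apply/asboolP; exists (fE g) => //.
split=> [/(can_inj fVK) //|w].
rewrite -{1}[w]kVK inc incg; split=> -[].
- by move=> <-; left; rewrite kVK.
- by move=> <-; right; rewrite kVK.
- by move=> ->; left; rewrite fVK.
- by move=> ->; right; rewrite fVK.
Qed.

Variables (R : realType) (p : R).
Hypothesis p01 : 0 <= p <= 1.
Hypothesis tilingH : is_tiling H.
Hypothesis E_gt0 : (0 < #|E|)%N.

(** Boundaries are cycles, and the dual graph is connected. *)
Lemma mean_rank_difference_ge : connected_graph (dual H) ->
  #|F|%:R / #|E|%:R - p - #|E|%:R^-1 <= mean_rank_difference H p.
Proof.
move=> connected; have [_ simple' _ _] := tilingH.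
have E_neq0 : #|E|%:R != 0 :> R by rewrite pnatr_eq0 -lt0n.
have -> : #|F|%:R / #|E|%:R - p - #|E|%:R^-1 =
    bernoulli_expectation p (fun eps : {set E} =>
      (#|F|%:R - 1) / #|E|%:R + - #|E|%:R^-1 * #|eps|%:R).
  rewrite bernoulli_expectationD bernoulli_expectation_cst.
  rewrite bernoulli_expectationZ bernoulli_expectation_card.
  by field.
apply: le_bernoulli_expectation => // eps.
rewrite mulNr [_^-1 * _]mulrC -mulrBl ler_wpM2r ?invr_ge0 ?ler0n //.
rewrite subgraph_rank_dualE subgraph_rankE.
have lower := rank_select_lower eps (face_edge_vertex_mx tilingH).
have rankB := rank_face_edge_mx simple' connected.
have : (#|F| + \rank (select _ eps *m edge_vertex_mx H) <=
    1 + #|eps| + \rank (face_edge_mx H *m (select _ (~: eps))^T))%N.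
  have arith (f b a c r : nat) :
      (f <= b.+1 -> b + a <= c + r -> f + a <= 1 + c + r)%N by lia.
  exact: arith rankB lower.
by rewrite -(ler_nat R) !natrD; lra.
Qed.

(** The cycles that do not bound are at most as many as the edges on long paths,
    and the expected number of these is bounded edge by edge. *)
Lemma mean_rank_difference_le N delta :
  (forall u s, path (adjb H setT) u s -> (size s <= N + N)%N -> last u s = u ->
    exists Y : seq F, forall g,
      crossings H g (u :: s) = \sum_(f <- Y) (incF H f g)%:R) ->
  (forall g, bernoulli_expectation p (fun eps : {set E} =>
     (g \in long_path_edges H eps N)%:R) <= delta) ->
  mean_rank_difference H p <= #|F|%:R / #|E|%:R - p + delta.
Proof.
move=> short le_delta; have [simple _ _ _] := tilingH.
have E_neq0 : #|E|%:R != 0 :> R by rewrite pnatr_eq0 -lt0n.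
apply: (@le_trans _ _ (bernoulli_expectation p (fun eps : {set E} =>
  (#|F|%:R / #|E|%:R + - #|E|%:R^-1 * #|eps|%:R)
    + #|E|%:R^-1 * \sum_g (g \in long_path_edges H eps N)%:R))).
  apply: le_bernoulli_expectation => // eps.
  rewrite mulNr [_^-1 * _]mulrC [_^-1 * _]mulrC -mulrBl -mulrDl.
  rewrite ler_wpM2r ?invr_ge0 ?ler0n //.
  rewrite subgraph_rank_dualE subgraph_rankE.
  have -> : \sum_g (g \in long_path_edges H eps N)%:R =
            #|long_path_edges H eps N|%:R :> R.
    rewrite -sum1_card natr_sum [RHS]big_mkcond.
    by apply: eq_bigr => g _; case: ifP.
  have upper := rank_select_upper (long_path_edges_sub H eps N)
    (cycle_sub_boundary simple eps short).
  have rankB := rank_leq_row (face_edge_mx H).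
  have : (#|eps| + \rank (face_edge_mx H *m (select _ (~: eps))^T) <=
      #|F| + \rank (select _ eps *m edge_vertex_mx H)
        + #|long_path_edges H eps N|)%N.
    have arith (f b a c r l : nat) :
        (b <= f -> c + r <= b + a + l -> c + r <= f + a + l)%N by lia.
    exact: arith rankB upper.
  by rewrite -(ler_nat R) !natrD; lra.
rewrite !bernoulli_expectationD bernoulli_expectation_cst.
rewrite !bernoulli_expectationZ bernoulli_expectation_card.
rewrite bernoulli_expectation_sum.
rewrite mulNr [_^-1 * (p * _)]mulrC mulfK // lerD2l.
rewrite ler_pdivrMl ?ltr0n // mulr_natl -sumr_const.
exact: ler_sum.
Qed.

End FiniteTilingBounds.

(** * The probability of a long open path *)

Section LongPathProbability.
Variables (V : eqType) (E F : Type) (G : tiling V E F) (w : V) (e : E).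
Hypotheses (simpleG : simple_graph G) (we : incV G w e).
Variables (R : realType) (d : measure_display) (Omega : measurableType d).
Variables (open : E -> set Omega) (P : probability Omega R) (q : R).
Hypothesis percolation : bernoulli_percolation P open q.

Definition long_path_event N : set Omega :=
  [set x | on_long_path G [set g | open g x] N e].

Lemma measurable_long_path_event (J : finType) (j : J -> E) N :
  (forall g, ball_edges G w N.+1 g -> exists i, j i = g) ->
  measurable (long_path_event N).
Proof.
move=> cover.
pose Phi (S : {set J}) := `[< on_long_path G (j @` [set i | i \in S]) N e >].
have -> : long_path_event N = [set x | Phi (open_indices j open x)].
  apply/seteqP; split=> x /=.
    move=> /(on_long_path_ball simpleG we) long; apply/asboolP.
    apply: on_long_path_mono long => g [og /cover[i ij]].
    by exists i => //=; rewrite inE; apply/asboolP; rewrite ij.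
  move=> /asboolP; apply: on_long_path_mono => _ [i /= iS <-].
  by move: iS; rewrite inE => /asboolP.
exact/measurable_open_indices/(percolation_measurable percolation).
Qed.

(** A chart sends long paths through [g] injectively to long paths through
    [e], and only finitely many edges are concerned.  The parameter may be
    raised because the existence of a long path is an increasing event. *)
Lemma long_path_probability_le (VH EH FH : finType) (H : tiling VH EH FH)
    t r fV fE DV DE g N (p : R) :
  simple_graph H -> chart H G t r w fV fE DV DE ->
  incV H r g -> fE g = e -> (N < t)%N ->
  measurable (long_path_event N) ->
  0 <= p -> p <= q -> q <= 1 ->
  ((bernoulli_expectation p
     (fun eps : {set EH} => (g \in long_path_edges H eps N)%:R))%:E
   <= P (long_path_event N))%E.
Proof.
move=> simpleH chartHG rg eg Nt meas p0 pq q1.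
pose J : finType := {x : EH | `[< DE x >]}.
pose j (i : J) := fE (val i).
have j_inj : injective j.
  move=> i k eq_ik; apply: val_inj.
  apply: (chart_injE chartHG) eq_ik; first exact/asboolP/(valP i).
  exact/asboolP/(valP k).
pose Phi (S : {set J}) := `[< on_long_path G (j @` [set i | i \in S]) N e >].
pose PhiR (S : {set J}) : R := (Phi S)%:R.
apply: (@le_trans _ _ (P [set x | Phi (open_indices j open x)])); last first.
  apply: le_measure; rewrite ?inE //.
    exact/measurable_open_indices/(percolation_measurable percolation).
  move=> x /asboolP; apply: on_long_path_mono => _ [i /= iS <-].
  by move: iS; rewrite inE => /asboolP.
have q0 : 0 <= q by apply: le_trans pq.
rewrite (probability_open_indices (percolation_measurable percolation)
  percolation j_inj).
rewrite lee_fin.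
apply: (@le_trans _ _ (bernoulli_expectation p PhiR)); last first.
  apply: bernoulli_expectation_mono => // S S' /fintype.subsetP SS'.
  rewrite ler_nat; case: (boolP (Phi S)) => // /asboolP long.
  rewrite (_ : Phi S'); first by [].
  apply/asboolP; apply: on_long_path_mono long => _ [i /= iS <-].
  by exists i => //=; apply: SS'.
have valJ_inj : injective (val : J -> EH) := val_inj.
rewrite -(bernoulli_expectation_preim p PhiR valJ_inj).
apply: le_bernoulli_expectation => [|eps]; first by rewrite p0 (le_trans pq).
rewrite ler_nat; case: (boolP (g \in _)) => //; rewrite inE => /asboolP long.
rewrite (_ : Phi _); first by [].
have [Dg] := chart_long_path simpleH chartHG rg Nt long; rewrite eg => longG.
apply/asboolP; apply: on_long_path_mono longG => _ [h [/= heps /asboolP Dh] <-].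
by exists (exist _ h Dh : J) => //=; rewrite inE.
Qed.

(** The events decrease to the event that [e] lies in an infinite cluster. *)
Lemma long_path_event_cvg0 :
  (forall N, measurable (long_path_event N)) ->
  (forall v N, finite_set (ball_vertices G v N)) ->
  fine (P [set x | infinite_cluster G [set g | open g x] e]) = 0 ->
  (fun N => fine (P (long_path_event N))) @ \oo --> 0.
Proof.
move=> meas balls.
rewrite (_ : [set x | _] = \bigcap_N long_path_event N); last first.
  apply/seteqP; split=> x /=.
    move=> /(infinite_cluster_long_path _ _ simpleG balls) long N _.
    exact: long.
  move=> long; apply/(infinite_cluster_long_path _ _ simpleG balls) => N.
  exact: long.
have meascap : measurable (\bigcap_N long_path_event N).
  by apply: bigcapT_measurable.
move=> Pcap0; apply: fine_cvg.
have <- : P (\bigcap_N long_path_event N) = 0%:E.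
  by rewrite -Pcap0 fineK // fin_num_measure.
apply: nonincreasing_cvg_mu => //.
  by rewrite (le_lt_trans (probability_le1 _ (meas 0%N))) ?ltry.
move=> N N' NN'; apply/subsetPset => x; exact: on_long_path_leq.
Qed.

End LongPathProbability.

Lemma left_cosets_inhabited (gT : finGroupType) (x : gT) :
  exists X : left_cosets x, True.
Proof.
have cycX : is_left_coset <[x]>%g <[x]>%g.
  by apply/lcosetsP; exists 1%g; rewrite ?finset.in_setT ?lcoset1.
by exists (exist (is_left_coset <[x]>%g) <[x]>%g cycX).
Qed.

(** * The quotient tilings *)

Section QuotientTilings.
Variables (m : nat) (V : eqType) (E F : Type) (G : tiling V E F).
Hypothesis planar : regular_planar_tiling m G.

Lemma planar_simple : simple_graph G.
Proof. by case: planar => -[[]]. Qed.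

Section OneQuotient.
Variables (t : nat) (gT : finGroupType) (a b : gT).
Hypothesis quotient : quotient_tiling m G t a b.
Let H := coset_tiling a b.

Lemma quotient_simple : simple_graph H.
Proof. by case: (qt_tiling quotient). Qed.

Lemma quotient_chart w : exists r fV fE DV DE, [/\ chart H G t r w fV fE DV DE &
  forall g, ball_edges G w t g -> exists2 h, DE h & fE h = g].
Proof.
have [u _] := left_cosets_inhabited a; have [_ reg _] := planar.
exact: (chart_exists planar_simple (qt_regular quotient) reg
  (qt_balls quotient u w)).
Qed.

Lemma quotient_finite_ball w : finite_set (ball_vertices G w t).
Proof.
have [u _] := left_cosets_inhabited a.
have [fV [fE [fF [[[_ _ surj] _ _] _ _]]]] := qt_balls quotient u w.
by apply: sub_finite_set surj _; apply: finite_image.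
Qed.

Lemma quotient_card_vertices w : long_path G setT t w ->
  (t < #|{: left_cosets a}|)%N.
Proof.
move=> [s [ws sizes s_uniq]].
have [u _] := left_cosets_inhabited a.
have [fV [fE [fF [[[_ _ surj] _ _] _ _]]]] := qt_balls quotient u w.
have s_im : {subset w :: s <= map fV (enum {: left_cosets a})}.
  move=> v vs; have : ball_vertices G w t v.
    case/splitPl: vs ws sizes {s_uniq} => s1 s2 lasts1.
    rewrite cat_path size_cat => /andP[ws1 _] <-; exists s1.
    by split; [apply/walkP|exact: lasts1|apply: leq_addr].
  by move=> /surj[x _ <-]; apply: map_f; rewrite mem_enum.
by have := uniq_leq_size s_uniq s_im; rewrite size_map -cardE /= sizes.
Qed.

Lemma quotient_card_edges :
  (m * #|{: left_cosets a}| = 2 * #|{: left_cosets (a * b)%g}|)%N /\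
  (m * #|{: left_cosets b}| = 2 * #|{: left_cosets (a * b)%g}|)%N.
Proof.
split.
  exact: (regular_double_count quotient_simple (qt_regular quotient)).
have [_ simple' _ _] := qt_tiling quotient.
exact: (regular_double_count simple' (qt_face_length quotient)).
Qed.

(** By vertex-transitivity the closed walk may be moved to the centre of a
    chart. *)
Lemma quotient_short_closed_walks w L k : (L <= t)%N -> (k <= t)%N ->
  (forall s, path (adjb G setT) w s -> (size s <= L)%N -> last w s = w ->
    exists Y : seq F,
      (forall i, (i < size Y)%N -> forall f0, ball_faces G w k (nth f0 Y i)) /\
      (forall g, crossings G g (w :: s) = \sum_(f <- Y) (incF G f g)%:R)) ->
  forall u s, path (adjb H setT) u s -> (size s <= L)%N -> last u s = u ->
    exists Y : seq (left_cosets b), forall g,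
      crossings H g (u :: s) = \sum_(f <- Y) (incF H f g)%:R.
Proof.
move=> Lt kt bound u s us sL lasts.
have [r [fV [fE [DV [DE [chartr _]]]]]] := quotient_chart w.
have [hV [hE [hF [iso hu]]]] := qt_vertex_transitive quotient u r.
have chartu := chart_iso iso hu chartr.
have st : (size s <= t)%N by apply: leq_trans Lt.
have [Ds usD] := chart_walk chartu us st.
have pathG : path (adjb G setT) w (map (fV \o hV) s).
  rewrite -(chart_center chartu); apply: path_setT.
  exact: (chart_path chartu Ds (path_setI quotient_simple us usD)).
have [||Y [Yk crY]] := bound _ pathG.
- by rewrite size_map.
- by rewrite -(chart_center chartu) last_map lasts.
apply: (chart_boundary quotient_simple chartu us st (Y := Y)).
  by move=> i iY f0; apply: ball_faces_mono kt _ (Yk i iY f0).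
by move=> g; rewrite -crY map_cons (chart_center chartu).
Qed.

Lemma quotient_dual_connected : connected_graph (dual H).
Proof.
have [fV [fE [fF iso]]] := qt_self_dual quotient.
exact: connected_iso iso (qt_connected quotient).
Qed.

(** By edge-transitivity [g] may be moved to the edge that corresponds to [e] in
    a chart centred at an end of [e]. *)
Lemma quotient_long_path_probability_le (R : realType) (d : measure_display)
    (Omega : measurableType d) (open : E -> set Omega) (P : probability Omega R)
    (p q : R) w e N g :
  bernoulli_percolation P open q -> incV G w e -> (N < t)%N ->
  0 <= p -> p <= q -> q <= 1 ->
  measurable (long_path_event G e open N) /\
  ((bernoulli_expectation p
      (fun eps : {set left_cosets (a * b)%g} =>
         (g \in long_path_edges H eps N)%:R))%:E
     <= P (long_path_event G e open N))%E.
Proof.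
move=> percolation we Nt p0 pq q1.
have [r [fV [fE [DV [DE [chartr cover]]]]]] := quotient_chart w.
have meas : measurable (long_path_event G e open N).
  apply: (measurable_long_path_event planar_simple we percolation (j := fE)).
  move=> h ballh; have [i _ <-] := cover h (ball_edges_mono Nt ballh).
  by exists i.
split=> //; have [e' De' ee'] : exists2 e', DE e' & fE e' = e.
  apply: cover; apply: (ball_edges_mono (k := 1%N)); first exact: leq_trans Nt.
  apply: (ball_edges_incident planar_simple) we; exact: ball_vertices_center.
have re' : incV H r e'.
  by apply: (chart_incident_center quotient_simple chartr De'); rewrite ee'.
have [hV [hE [hF [iso he]]]] := qt_edge_transitive quotient g e'.
have [kV hVK kVK] := iso_bijV iso.
have charth := chart_iso iso (kVK r) chartr.
apply: (long_path_probability_le percolation quotient_simple charth) => //.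
  by rewrite -(iso_incV iso) he kVK.
by rewrite /= he.
Qed.

End OneQuotient.
End QuotientTilings.

(** * The subcritical limit *)

Section RankDifferenceLimit.
Variables (R : realType) (m : nat) (V : eqType) (E F : Type) (G : tiling V E F).
Variables (gT : nat -> finGroupType) (a b : forall t, gT t).
Variables (d : measure_display) (Omega : measurableType d).
Variables (open : E -> set Omega) (P : probability Omega R).
Variables (p q : R) (w : V) (e : E).
Hypotheses (m_ge2 : (2 <= m)%N) (planar : regular_planar_tiling m G).
Hypothesis quotients :
  forall t, (m <= t)%N -> quotient_tiling m G t (a t) (b t).
Hypothesis percolation : bernoulli_percolation P open q.
Hypotheses (p_ge0 : 0 <= p) (p_le_q : p <= q) (q_le1 : q <= 1).
Hypothesis we : incV G w e.

Lemma planar_finite_ball v N : finite_set (ball_vertices G v N).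
Proof.
have := quotient_finite_ball (quotients (leq_maxl m N)) v.
by apply: sub_finite_set; apply: ball_vertices_mono (leq_maxr m N).
Qed.

(** The infinite graph contains simple paths of all lengths, and the one of
    length [t] lies in a ball that the finite tiling copies.  There are at
    least as many edges as vertices because degrees are at least 2. *)
Lemma quotient_card_edges_gt t : (m <= t)%N ->
  (t < #|{: left_cosets (a t * b t)%g}|)%N.
Proof.
move=> mt; have [[_ connected _ infV] _ _] := planar.
have long : long_path G setT t w.
  apply: long_path_infinite => [N|]; first exact: planar_finite_ball.
  rewrite (_ : component G setT w = setT) //.
  by apply/seteqP; split=> // v _; apply: connected.
have cardV := quotient_card_vertices (quotients mt) long.
have [double _] := quotient_card_edges (quotients mt).
apply: leq_trans cardV _; rewrite -(leq_pmul2l (isT : 0 < 2)%N) -double.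
by rewrite leq_mul2r m_ge2 orbT.
Qed.

Lemma quotient_mean_rank_difference_ge t : (m <= t)%N ->
  2 / m%:R - p - t%:R^-1 <=
    mean_rank_difference (coset_tiling (a t) (b t)) p.
Proof.
move=> mt; have Q := quotients mt; have E_gt := quotient_card_edges_gt mt.
have E_gt0 := leq_ltn_trans (leq0n t) E_gt.
have t_gt0 : (0 < t)%N by apply: leq_trans mt; apply: ltnW.
apply: le_trans (mean_rank_difference_ge _ (qt_tiling Q) E_gt0
  (quotient_dual_connected Q)); last by rewrite p_ge0 (le_trans p_le_q).
have [_ double] := quotient_card_edges Q.
have m_neq0 : m%:R != 0 :> R by rewrite pnatr_eq0 -lt0n ltnW.
have E_neq0 : #|{: left_cosets (a t * b t)%g}|%:R != 0 :> R.
  by rewrite pnatr_eq0 -lt0n.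
have -> : 2 / m%:R = #|{: left_cosets (b t)}|%:R
                     / #|{: left_cosets (a t * b t)%g}|%:R :> R.
  apply/eqP; rewrite eqr_div // -!natrM eqr_nat; apply/eqP.
  by rewrite [RHS]mulnC; apply: esym.
by rewrite lerD2l lerN2 lef_pV2 ?posrE ?ltr0n // ler_nat ltnW.
Qed.

Lemma quotient_mean_rank_difference_le N : exists t0, forall t, (t0 <= t)%N ->
  mean_rank_difference (coset_tiling (a t) (b t)) p <=
    2 / m%:R - p + fine (P (long_path_event G e open N)).
Proof.
have [[[simple _ face_cycle _] connected sc _] _ _] := planar.
have [k bound] := short_closed_walks_bound simple connected face_cycle sc
  (planar_finite_ball w) (N + N).
exists (maxn (maxn m N.+1) (maxn (N + N) k)) => t.
rewrite !geq_max => /andP[/andP[mt Nt] /andP[NNt kt]].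
have Q := quotients mt; have E_gt := quotient_card_edges_gt mt.
have E_gt0 := leq_ltn_trans (leq0n t) E_gt.
have short := quotient_short_closed_walks planar Q NNt kt bound.
have prob g := quotient_long_path_probability_le planar Q g percolation we Nt
  p_ge0 p_le_q q_le1.
have p01 : 0 <= p <= 1 by rewrite p_ge0 (le_trans p_le_q).
have prob_le g : bernoulli_expectation p
    (fun eps : {set left_cosets (a t * b t)%g} =>
       (g \in long_path_edges (coset_tiling (a t) (b t)) eps N)%:R)
    <= fine (P (long_path_event G e open N)).
  have [meas le_P] := prob g.
  by rewrite -lee_fin fineK // fin_num_measure.
apply: le_trans
  (mean_rank_difference_le p01 (qt_tiling Q) E_gt0 short prob_le) _.
have [_ double] := quotient_card_edges Q.
have m_neq0 : m%:R != 0 :> R by rewrite pnatr_eq0 -lt0n ltnW.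
have E_neq0 : #|{: left_cosets (a t * b t)%g}|%:R != 0 :> R.
  by rewrite pnatr_eq0 -lt0n.
rewrite (_ : #|{: left_cosets (b t)}|%:R / _ = 2 / m%:R) //.
apply/eqP; rewrite eqr_div // -!natrM eqr_nat; apply/eqP.
by rewrite mulnC.
Qed.

(** The upper bound is used with [N] fixed before [t], so that the radius needed
    for the closed walks of length [2N] is eventually exceeded. *)
Lemma rank_difference_subcritical :
  fine (P [set x | infinite_cluster G [set g | open g x] e]%classic) = 0 ->
  rank_difference a b p = 2 / m%:R - p.
Proof.
move=> P0; suff lim :
    (mean_rank_difference (coset_tiling (a t) (b t)) p @[t --> \oo]
       --> 2 / m%:R - p)%classic.
  by rewrite /rank_difference (cvg_limn_inf_sup lim).
have meas N : measurable (long_path_event G e open N).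
  have le_t : (m <= maxn m N.+1)%N := leq_maxl m N.+1.
  have [g0 _] := left_cosets_inhabited (a (maxn m N.+1) * b (maxn m N.+1))%g.
  by case: (quotient_long_path_probability_le planar (quotients le_t) g0
    percolation we (leq_maxr m N.+1) p_ge0 p_le_q q_le1).
have := long_path_event_cvg0 (planar_simple planar) meas planar_finite_ball P0.
move=> /cvgrPdist_le event0.
apply/cvgrPdist_le => eps eps_gt0.
have [N _ /(_ N (leqnn N)) /=] := event0 _ eps_gt0.
rewrite sub0r normrN ger0_norm ?fine_ge0 // => PN.
have [t0 upper] := quotient_mean_rank_difference_le N.
near=> t.
have t0t : (t0 <= t)%N by near: t; apply: nbhs_infty_ge.
have mt : (m <= t)%N by near: t; apply: nbhs_infty_ge.
have t_eps : t%:R^-1 <= eps.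
  have bound_t : (Num.bound eps^-1 <= t)%N by near: t; apply: nbhs_infty_ge.
  have eps_t : eps^-1 <= t%:R.
    apply: ltW; apply: (lt_le_trans (archi_boundP _)).
      by rewrite invr_ge0 ltW.
    by rewrite ler_nat.
  rewrite -[leRHS]invrK lef_pV2 // posrE ?invr_gt0 //.
  by rewrite (lt_le_trans _ eps_t) ?invr_gt0.
have lower := quotient_mean_rank_difference_ge mt.
have := upper t t0t; rewrite ler_distl => up.
by apply/andP; split; lra.
Unshelve. all: by end_near.
Qed.

End RankDifferenceLimit.

Theorem theorem4p5 (R : realType) (m : nat)
    (V E F : Type) (G : tiling V E F)
    (gT : nat -> finGroupType) (a b : forall t, gT t)
    (d : measure_display) (Omega : measurableType d)
    (P : R -> probability Omega R) (open : R -> E -> set Omega)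
    (e : E) (p : R) :
  (5 <= m)%N ->
  regular_planar_tiling m G ->
  finite_tilings m G a b ->
  (forall q : R, 0 <= q <= 1 -> bernoulli_percolation (P q) (open q) q) ->
  0 <= p ->
  p < critical_probability G P open e ->
  p - 2 / m%:R + rank_difference a b p = 0.
Proof.
move=> m_ge5 planar [quotients _] percolation p_ge0 p_lt.
(* Simple paths need decidable equality on the vertices: {classic V} is V. *)
have [x [y xy]] := (planar_simple (V := {classic V}) planar).1 e.
set S := [set q | 0 <= q <= 1 /\ percolation_function G P open e q = 0]%classic.
have [q [q01 q_perc] pq] : exists2 q, S q & p < q.
  have S_neq0 : (S !=set0)%classic.
    apply/set0P/eqP => S0; move: p_lt.
    by rewrite /critical_probability -/S S0 sup0 ltNge p_ge0.
  exact: sup_gt.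
have /andP[_ q_le1] := q01.
have m_ge2 : (2 <= m)%N by apply: leq_trans m_ge5.
have -> := @rank_difference_subcritical R m {classic V} E F G gT a b d Omega
  (open q) (P q) p q x e m_ge2 planar quotients (percolation q q01) p_ge0
  (ltW pq) q_le1 (endpoints_incl xy) q_perc.
by ring.
Qed.
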